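(* Let $n$ be an even positive integer and $m$ a positive integer. For a random chain complex $0\leftarrow A_0\xleftarrow{d_1}A_1\xleftarrow{d_2}\cdots\xleftarrow{d_n}A_n\leftarrow 0$ with $A_i=\mathbb R^{m}$ for every $i=0,\dots,n$, almost surely $\sum_{i=0}^n\beta_i=|\chi|$, where $\chi=\sum_{i=0}^n(-1)^i m$. Moreover, almost surely $\beta_i=0$ for $i=1,3,\dots,n-1$.
   Context: Model of a random chain complex: fix nonnegative integers $\vec a=(a_0,\dots,a_n)$ and $A_i=\mathbb R^{a_i}$. A sequence of linear maps $d_i:A_i\to A_{i-1}$ ($i=1,\dots,n$) is a point of $\mathbb R^N$, $N=\sum_{i=1}^n a_{i-1}a_i$. Let $M(\vec a)\subseteq\mathbb R^N$ be the real affine algebraic variety of chain complexes ($d_i\circ d_{i+1}=0$ for all $i$); let $k$ be its Hausdorff dimension. Fix a bounded measurable probability density $f$ on $\mathbb R^N$ (e.g.\ standard Gaussian) with $\int_{M(\vec a)} f\,d\mathcal H^k>0$. For a subvariety $Y\subseteq M(\vec a)$ define $\Pr(Y)=\int_Y f\,d\mathcal H^k/\int_{M(\vec a)} f\,d\mathcal H^k$, $\mathcal H^k$ the $k$-dimensional Hausdorff measure. A random chain complex is a point of $M(\vec a)$ under this measure; ''almost surely'' means with probability $1$. Betti numbers: with $r_i=\operatorname{rank} d_i$ and $r_0=r_{n+1}=0$, $\beta_i=a_i-r_i-r_{i+1}$. *)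

(* Defs.v *)
From HB Require Import structures.
From mathcomp Require Import all_boot all_order all_algebra.
From mathcomp Require Import all_classical all_reals all_analysis.
Set Implicit Arguments. Unset Strict Implicit. Unset Printing Implicit Defensive.
Import Order.TTheory GRing.Theory Num.Theory.
Local Open Scope classical_set_scope.
Local Open Scope ring_scope.

Section RandomChainComplex.
Variables (R : realType) (a : nat -> nat) (n : nat).

(* A point of R^N: a family d_1, ..., d_n of linear maps; the index i : 'I_n
   stands for d_{i+1} : A_{i+1} -> A_i, an (a_i x a_{i+1}) real matrix
   acting on column vectors. *)
Definition chpt := forall i : 'I_n, 'M[R]_(a i, a i.+1).

Definition cdist (x y : chpt) : R :=
  Num.sqrt (\sum_(i < n) \sum_(r < a i) \sum_(c < a i.+1) (x i r c - y i r c) ^+ 2).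

Definition cball (x : chpt) (e : R) : set chpt := [set y | cdist x y < e].

Definition cborel : set (set chpt) :=
  <<s [set B | exists x e, 0 < e /\ B = cball x e] >>.

Definition cborel_fun (f : chpt -> R) : Prop :=
  forall t : R, cborel [set x | f x < t].

Definition cdiam (U : set chpt) : \bar R :=
  ereal_sup [set z | exists x y, U x /\ U y /\ z = (cdist x y)%:E].

Definition hterm (s : R) (U : set chpt) : \bar R :=
  if `[< U !=set0 >] then ((fine (cdiam U)) `^ s)%:E else 0%E.

Definition hausdorff_delta (s delta : R) (A : set chpt) : \bar R :=
  ereal_inf [set z | exists U : nat -> set chpt,
    A `<=` \bigcup_j U j /\ (forall j, (cdiam (U j) <= delta%:E)%E) /\
    z = (\sum_(j <oo) hterm s (U j))%E].

(* s-dimensional Hausdorff (outer) measure: lim_{delta -> 0} = sup_{delta>0} *)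
Definition hausdorff (s : R) (A : set chpt) : \bar R :=
  ereal_sup [set z | exists delta, 0 < delta /\ z = hausdorff_delta s delta A].

Definition hdim (A : set chpt) : R :=
  inf [set s : R | 0 <= s /\ hausdorff s A = 0%E].

Definition lintegral (mu : set chpt -> \bar R) (Y : set chpt)
  (f : chpt -> R) : \bar R :=
  ereal_sup [set z | exists (k : nat) (c : nat -> R) (E : nat -> set chpt),
    (forall i, (i < k)%N ->
       [/\ cborel (E i), E i `<=` Y, 0 <= c i & forall x, E i x -> c i <= f x])
    /\ (forall i j, (i < k)%N -> (j < k)%N -> i != j -> E i `&` E j = set0)
    /\ z = (\sum_(i < k) (c i)%:E * mu (E i))%E].

Definition is_chain (d : chpt) : Prop :=
  forall (i : nat) (Hi : (i.+1 < n)%N),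
    d (Ordinal (ltnW Hi)) *m d (Ordinal Hi) = 0.

Definition chain_variety : set chpt := [set d | is_chain d].

Definition kdim : R := hdim chain_variety.

Definition Pr (f : chpt -> R) (Y : set chpt) : R :=
  fine (lintegral (hausdorff kdim) Y f) /
  fine (lintegral (hausdorff kdim) chain_variety f).

(* rank r_j of d_j (j = 1..n), with r_0 = r_{n+1} = 0 *)
Definition crank (d : chpt) (j : nat) : nat :=
  if j is j'.+1 then
    (if insub j' is Some i then \rank (d i) else 0%N)
  else 0%N.

Definition betti (d : chpt) (j : nat) : int :=
  (a j)%:Z - (crank d j)%:Z - (crank d j.+1)%:Z.

Definition euler_char : int := \sum_(i < n.+1) (-1) ^+ i * (a i)%:Z.

End RandomChainComplex.

Arguments chain_variety R a n : clear implicits.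
Arguments kdim R a n : clear implicits.

(* Main.v *)
(* Let r_i be the rank of d_i and let beta_i = m - r_i - r_{i+1}.  The complexes
   with prescribed ranks form a stratum whose dimension F satisfies
   2 F = (n+1) m^2 - sum_i beta_i^2, while the alternating sum of the beta_i is
   m.  If some beta_i with i odd is nonzero, the even Betti numbers add up to
   more than m, and F is strictly smaller than for the rank vector whose odd
   Betti numbers vanish and whose even ones are as equal as possible.  Call that
   maximum K.

   A stratum is a countable union of charts: choosing pivot rows and columns for
   every d_i, the complex is a Lipschitz function of F of its entries, so a chart
   of dimension F < K is null for the K-dimensional measure.  Conversely the
   optimal chart projects onto a K-dimensional box, so the Hausdorff dimension of
   the variety is at least K.  Hence the complexes with a nonzero odd Betti
   number are negligible; for all others the even Betti numbers add up to m. *)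
Require Import Defs.
From HB Require Import structures.
From mathcomp Require Import all_boot all_order all_algebra.
From mathcomp Require Import boolp.
From mathcomp Require Import zify ring lra.
Set Implicit Arguments. Unset Strict Implicit. Unset Printing Implicit Defensive.
Import Order.TTheory GRing.Theory Num.Theory.
Local Open Scope ring_scope.

(** * Dimensions of the rank strata *)

(** Counts free entries: [r i.+1] pivot rows are free in all [m] columns, and the [m - r i - r i.+1]
    rows that are neither pivot rows nor forced by the chain condition are free in the [r i.+1]
    pivot columns. *)
Definition stratum_dim (m n : nat) (r : nat -> nat) : nat :=
  (\sum_(i < n) r i.+1 * (m + (m - r i - r i.+1)))%N.

Definition rank_betti (m : nat) (r : nat -> nat) (i : nat) : int :=
  m%:Z - (r i)%:Z - (r i.+1)%:Z.

Definition rank_vector (m n : nat) (r : nat -> nat) : Prop :=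
  [/\ r 0%N = 0%N, r n.+1 = 0%N & forall i, (i <= n)%N -> (r i + r i.+1 <= m)%N].

(* Since the alternating sum of the [b_i] is [m], the sum of these costs differs
   from the sum of the [b_i ^ 2] by a constant.  With [q = m %/ n./2.+1] the
   cost is minimal, for even [i], exactly at [b = q] and [b = q + 1]. *)
Definition betti_cost (q : nat) (b : int) (i : nat) : int :=
  if odd i then b ^+ 2 + (q.*2.+1)%:Z * b else b ^+ 2 - (q.*2.+1)%:Z * b.

(** Induction on [k]: with b = m - r_k - r_{k+1}, twice the new dimension term plus b^2 equals m^2 +
    2m(r_{k+1} - r_k) + r_k^2 - r_{k+1}^2, which telescopes; so does the alternating sum of the
    Betti numbers. *)
Lemma stratum_dim_partial (m n q k : nat) (r : nat -> nat) :
  rank_vector m n r -> (k <= n.+1)%N ->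
  (stratum_dim m k r)%:Z * 2 + \sum_(i < k) betti_cost q (rank_betti m r i) i =
  k%:Z * m%:Z ^+ 2 + 2 * m%:Z * (r k)%:Z - (r k)%:Z ^+ 2
  - (q.*2.+1)%:Z * (if odd k then m%:Z - (r k)%:Z else (r k)%:Z).
Proof.
move=> [r0 rn rm]; elim: k => [|k IH] lek.
  by rewrite /stratum_dim !big_ord0 r0 /=; lia.
rewrite /stratum_dim !big_ord_recr /= PoszD mulrDl.
have := IH (ltnW lek); rewrite /stratum_dim => {}IH.
rewrite addrACA IH {IH} /betti_cost /rank_betti.
have rk := rm _ lek.
have -> : (r k.+1 * (m + (m - r k - r k.+1)))%N%:Z
   = (r k.+1)%:Z * (2 * m%:Z - (r k)%:Z - (r k.+1)%:Z) by nia.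
case: (odd k) => /=; nia.
Qed.

Lemma stratum_dim_cost (m n q : nat) (r : nat -> nat) :
  rank_vector m n r -> ~~ odd n ->
  (stratum_dim m n r)%:Z * 2 + \sum_(i < n.+1) betti_cost q (rank_betti m r i) i =
  n.+1%:Z * m%:Z ^+ 2 - (q.*2.+1)%:Z * m%:Z.
Proof.
move=> rv evn; have [r0 rn rm] := rv.
have := stratum_dim_partial q rv (leqnn _).
rewrite /= evn {1}/stratum_dim big_ord_recr /= -/(stratum_dim m n r) rn.
rewrite mul0n addn0 => ->; lia.
Qed.

(* The even Betti numbers of [best_rank] are the increments of [best_even], which
   spread [m] as equally as possible over the [n./2.+1] even degrees. *)
Definition best_even (m n j : nat) : nat := ((j * m) %/ n./2.+1)%N.

Definition best_rank (m n i : nat) : nat :=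
  if odd i then (m - best_even m n i.+1./2)%N else best_even m n i./2.

Lemma best_even_step (m n j : nat) :
  let q := (m %/ n./2.+1)%N in
  (best_even m n j + q <= best_even m n j.+1 <= best_even m n j + q + 1)%N.
Proof.
rewrite /best_even /=; set L := n./2.+1.
have e k : (k %/ L * L <= k < (k %/ L).+1 * L)%N.
  by rewrite leq_trunc_div ltn_ceil.
have /andP[a1 a2] := e m; have /andP[b1 b2] := e (j * m)%N.
have /andP[c1 c2] := e (j.+1 * m)%N.
have L0 : (0 < L)%N by [].
move: (m %/ L)%N (j * m %/ L)%N (j.+1 * m %/ L)%N a1 a2 b1 b2 c1 c2 => q c c'.
rewrite mulSn => a1 a2 b1 b2 c1 c2; apply/andP; split.
  rewrite -ltnS -(ltn_pmul2r L0); nia.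
rewrite -ltnS -(ltn_pmul2r L0); nia.
Qed.

Lemma best_even_le (m n j : nat) : (j <= n./2.+1)%N -> (best_even m n j <= m)%N.
Proof.
move=> lej; rewrite /best_even -(leq_pmul2r (ltn0Sn n./2)).
by apply: leq_trans (leq_trunc_div _ _) _; rewrite mulnC leq_mul2l lej orbT.
Qed.

Lemma best_rank_vector (m n : nat) : ~~ odd n -> rank_vector m n (best_rank m n).
Proof.
move=> evn; split.
- by rewrite /best_rank /best_even /= mul0n div0n.
- rewrite /best_rank /= evn /best_even /= mulnC mulnK // subnn //.
move=> i lei; rewrite /best_rank /=; case: ifP => /= oi.
  rewrite subnK // uphalfE best_even_le // -[X in (_ <= X)%N]/(n.+2./2).
  by apply: half_leq; rewrite ltnW.
have := best_even_step m n i./2;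
move=> /andP[]; have := @best_even_le m n i./2.+1; rewrite ltnS half_leq // => /(_ isT).
by move: (m %/ n./2.+1)%N => q; lia.
Qed.

(** Costs are compared degree by degree. In odd degrees b >= 0 makes the cost nonnegative, and
    positive at [i0]. In even degrees (b - q)(b - q - 1) >= 0 for every integer b, with equality at
    the two values that [best_rank] takes. *)
Lemma best_rank_optimal (m n : nat) (r : nat -> nat) (i0 : nat) :
  rank_vector m n r -> ~~ odd n -> odd i0 -> (i0 < n)%N ->
  rank_betti m r i0 != 0 ->
  (stratum_dim m n r < stratum_dim m n (best_rank m n))%N.
Proof.
move=> rv evn odd0 lt0 bad; set q := (m %/ n./2.+1)%N.
have bv := best_rank_vector m evn.
have e1 := stratum_dim_cost q rv evn; have e2 := stratum_dim_cost q bv evn.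
suff : \sum_(i < n.+1) betti_cost q (rank_betti m (best_rank m n) i) i <
       \sum_(i < n.+1) betti_cost q (rank_betti m r i) i by lia.
have best_odd i : odd i -> (i <= n)%N -> rank_betti m (best_rank m n) i = 0.
  move=> oi lei; rewrite /rank_betti /best_rank /= oi /= uphalfE.
  by have := @best_even_le m n i.+1./2; rewrite -[n./2.+1]/(n.+2./2) half_leq //; lia.
have le_cost i : (i <= n)%N ->
    betti_cost q (rank_betti m (best_rank m n) i) i <= betti_cost q (rank_betti m r i) i.
  move=> lei; have [_ _ /(_ _ lei) ri] := rv.
  rewrite /betti_cost; case: ifP => oi.
    by rewrite best_odd // /rank_betti; nia.
  have := best_even_step m n i./2; rewrite -/q /= => st.
  have := @best_even_le m n i./2.+1; rewrite ltnS half_leq // => /(_ isT) le1.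
  move: (rank_betti m r i) => b.
  have [d de dle] : exists2 d : nat, (d <= 1)%N &
     (best_even m n i./2.+1 = best_even m n i./2 + q + d)%N.
    by exists (best_even m n i./2.+1 - best_even m n i./2 - q)%N; lia.
  have -> : rank_betti m (best_rank m n) i = q%:Z + d%:Z.
    by rewrite /rank_betti /best_rank /= oi /=; lia.
  have : 0 <= (b - q%:Z) * (b - q%:Z - 1) by case: (lerP b q%:Z) => bq; nia.
  by case: d de {dle} => [|[|//]] _; nia.
rewrite [ltLHS](bigD1 (Ordinal (ltnW lt0 : (i0 < n.+1)%N))) //=.
rewrite [ltRHS](bigD1 (Ordinal (ltnW lt0 : (i0 < n.+1)%N))) //=.
apply: ltr_leD; last by apply: ler_sum => i _; apply: le_cost; rewrite -ltnS.
rewrite best_odd //; last exact: ltnW.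
rewrite /betti_cost odd0; have [_ _ /(_ _ (ltnW lt0))] := rv.
by move: bad; rewrite /rank_betti; nia.
Qed.

(** Strict optimality against the zero rank vector, whose Betti number in degree 1 is [m]. The
    null-set lemmas below take a positive exponent. *)
Lemma best_rank_dim_gt0 (m n : nat) : (0 < n)%N -> ~~ odd n -> (0 < m)%N ->
  (0 < stratum_dim m n (best_rank m n))%N.
Proof.
move=> n0 evn m0; apply: leq_ltn_trans (leq0n _)
  (@best_rank_optimal m n (fun=> 0%N) 1%N _ _ _ _ _) => //.
- by case: n n0 evn => [//|[|]].
- by rewrite /rank_betti; lia.
Qed.

(** Vanishing in odd degrees means r_k + r_{k+1} = m there, so the partial sums are read off the
    ranks. *)
Lemma betti_sum (m n : nat) (r : nat -> nat) :
  rank_vector m n r -> ~~ odd n ->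
  (forall i, odd i -> (i < n)%N -> rank_betti m r i = 0) ->
  \sum_(i < n.+1) rank_betti m r i = m%:Z.
Proof.
move=> [r0 rn rm] evn od.
suff H k : (k <= n.+1)%N ->
   \sum_(i < k) rank_betti m r i = if odd k then m%:Z - (r k)%:Z else (r k)%:Z.
  by rewrite H //= evn rn; lia.
elim: k => [|k IH] lek; first by rewrite big_ord0 r0.
rewrite big_ord_recr /= IH ?(ltnW lek) //=.
case: ifP => ok /=; last by rewrite /rank_betti; lia.
have := od k ok; rewrite /rank_betti; case: (ltngtP k n) => [kn|kn|kn].
- by move=> /(_ isT); lia.
- by move: lek; rewrite ltnS leqNgt kn.
- by move: ok; rewrite kn (negbTE evn).
Qed.

(** * Pivots and charts *)

Section PivotSets.
Variables (F : fieldType) (m : nat).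
Implicit Types (A B d G : 'M[F]_m) (I J : {set 'I_m}).

Definition coord_proj I : 'M[F]_m := diag_mx (\row_i (i \in I)%:R).

Lemma coord_projE I i j : coord_proj I i j = ((i == j) && (i \in I))%:R.
Proof.
rewrite !mxE; case: eqP => [->|_] /=; last by rewrite mulr0n.
by rewrite mulr1n.
Qed.

Lemma mul_coord_projl k I (A : 'M[F]_(m, k)) i j : (coord_proj I *m A) i j = (i \in I)%:R * A i j.
Proof.
by rewrite /coord_proj mul_diag_mx !mxE.
Qed.

Lemma mul_coord_projr k I (A : 'M[F]_(k, m)) i j : (A *m coord_proj I) i j = (j \in I)%:R * A i j.
Proof. by rewrite /coord_proj mul_mx_diag !mxE mulrC. Qed.

Lemma coord_proj_setI I J : coord_proj I *m coord_proj J = coord_proj (I :&: J).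
Proof.
apply/matrixP => i j; rewrite mul_coord_projl !coord_projE inE.
by rewrite -natrM mulnb andbCA.
Qed.

Lemma coord_proj_id I : coord_proj I *m coord_proj I = coord_proj I.
Proof. by rewrite coord_proj_setI setIid. Qed.

Lemma coord_proj0 : coord_proj set0 = 0.
Proof. by apply/matrixP => i j; rewrite coord_projE inE andbF mxE. Qed.

Lemma coord_projC I : coord_proj (~: I) = 1%:M - coord_proj I.
Proof.
apply/matrixP => i j; rewrite coord_projE !mxE inE.
by case: eqP => [->|_]; case: (_ \in I); rewrite /= ?mulr0n ?mulr1n ?subrr ?subr0.
Qed.

(* [G] is the inverse of the [I]x[J] block of [d], extended by zero; the last
   condition says that [d] has no rank outside this block. *)
Definition pivot_inverse I J d G : Prop :=
  [/\ coord_proj J *m G = G, G *m coord_proj I = G,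
      coord_proj I *m d *m G = coord_proj I,
      G *m d *m coord_proj J = coord_proj J & d *m G *m d = d].

Lemma sel_proj k (f : 'I_k -> 'I_m) : injective f ->
  (rowsub f 1%:M)^T *m (rowsub f 1%:M) = coord_proj [set f x | x in 'I_k].
Proof.
move=> injf; apply/matrixP => i j; rewrite coord_projE !mxE.
under eq_bigr do rewrite !mxE.
case: imsetP => [[x _ ->]|nx] /=.
  rewrite (bigD1 x) //= big1 ?addr0 ?eqxx ?andbT ?mul1r ?[f x == _]eq_sym // => y yx.
  by rewrite (inj_eq injf) (negbTE yx) mul0r.
rewrite andbF big1 // => x _; case: eqP => [fx|_]; last by rewrite mul0r.
by case: nx; exists x.
Qed.

(** By hypothesis the rows of [d] in [I0] span its row space. A maximal independent family of them,
    then of columns of the selected rows, cuts out an invertible block [B]; [G] is its inverse put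
    back in place. *)
Lemma pivot_exists d I0 E : d = E *m (coord_proj I0 *m d) ->
  exists I J G, [/\ I \subset I0, #|I| = \rank d, #|J| = \rank d & pivot_inverse I J d G].
Proof.
move=> dE; set A := coord_proj I0 *m d.
have rA : \rank A = \rank d.
  by apply/eqP; rewrite eqn_leq mxrankM_maxr {1}dE mxrankM_maxr.
pose r : nat := \rank A; pose f := maxrankfun A; pose S : 'M[F]_(r, m) := rowsub f 1%:M.
have injf : injective f by exact: maxrankfun_inj.
have SA : S *m A = rowsub f A by rewrite [RHS]rowsubE.
have freeSA : row_free (S *m A) by rewrite SA maxrowsub_free.
have fullSA : row_full (S *m A)^T by rewrite /row_full mxrank_tr.
pose g := fullrankfun fullSA; pose S' : 'M[F]_(r, m) := rowsub g 1%:M.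
have injg : injective g by exact: fullrankfun_inj.
pose B := S *m A *m S'^T.
have Bu : B \in unitmx.
  rewrite -unitmx_tr /B trmx_mul trmxK -rowsubE -row_full_unit.
  exact: fullrowsub_full.
(* A selected row outside [I0] would be a zero row of [A], against independence. *)
have fI0 x : f x \in I0.
  apply/negPn/negP => fx; have [C] := row_freeP freeSA.
  move/matrixP/(_ x x); rewrite SA mxE [RHS]mxE eqxx big1 => [/esym/eqP|j _].
    by rewrite oner_eq0.
  by rewrite mxE mul_coord_projl (negbTE fx) !mul0r.
have SI0 : S *m coord_proj I0 = S.
  apply/matrixP => x j; rewrite mul_coord_projr !mxE.
  by case: eqP => [<-|_]; rewrite ?mulr0 // fI0 mul1r.
have Sd : S *m A = S *m d by rewrite /A mulmxA SI0.
have SS : S *m S^T = 1%:M.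
  by apply/matrixP => x y; rewrite /S -rowsubE !mxE (inj_eq injf) eq_sym.
have SS' : S' *m S'^T = 1%:M.
  by apply/matrixP => x y; rewrite /S' -rowsubE !mxE (inj_eq injg) eq_sym.
(* The pivot rows span the row space of [d]; this yields [d *m G *m d = d]. *)
have [Y dY] : exists Y, d = Y *m (S *m d).
  apply/submxP; rewrite -Sd SA eq_maxrowsub; apply/submxP; exists E; exact: dE.
exists [set f x | x in 'I_r], [set g x | x in 'I_r], (S'^T *m invmx B *m S); split.
- by apply/subsetP => _ /imsetP[x _ ->].
- by rewrite card_imset // card_ord.
- by rewrite card_imset // card_ord.
have BE : S *m d *m S'^T = B by rewrite /B Sd.
rewrite /pivot_inverse -!(sel_proj injf) -!(sel_proj injg) -/S -/S'; split.
- by rewrite !mulmxA -[S'^T *m S' *m S'^T]mulmxA SS' mulmx1.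
- by rewrite -!mulmxA [S *m (S^T *m S)]mulmxA SS mul1mx.
- have -> : S^T *m S *m d *m (S'^T *m invmx B *m S) = S^T *m (B *m invmx B) *m S.
    by rewrite -BE !mulmxA.
  by rewrite mulmxV // mulmx1.
- have -> : S'^T *m invmx B *m S *m d *m (S'^T *m S') = S'^T *m (invmx B *m B) *m S'.
    by rewrite -BE !mulmxA.
  by rewrite mulVmx // mulmx1.
have -> : d *m (S'^T *m invmx B *m S) *m d = Y *m (B *m invmx B) *m (S *m d).
  by rewrite {1}dY -BE !mulmxA.
by rewrite mulmxV // mulmx1.
Qed.

End PivotSets.

(** * Bounded Lipschitz functions *)

Section BoundedLipschitz.
Variables (R : realFieldType) (W : Type) (D : W -> Prop) (near : R -> W -> W -> Prop).

(** Boundedness is included because it keeps products Lipschitz. The relation [near e] will compare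
    chart coordinates only. *)
Definition bounded_lip (g : W -> R) : Prop :=
  exists C, [/\ 0 <= C, forall w, D w -> `|g w| <= C &
    forall w w' e, D w -> D w' -> 0 <= e -> near e w w' -> `|g w - g w'| <= C * e].

Definition bounded_lip_mx m (A : W -> 'M[R]_m) : Prop :=
  forall i j, bounded_lip (fun w => A w i j).

Lemma bounded_lip_ext g h :
  (forall w, D w -> g w = h w) -> bounded_lip g -> bounded_lip h.
Proof.
move=> gh [C [C0 gC1 gC2]]; exists C; split=> // [w Dw|w w' e Dw Dw' e0 ne].
  by rewrite -gh //; exact: gC1.
by rewrite -!gh //; exact: gC2.
Qed.

Lemma bounded_lip_cst c : bounded_lip (fun=> c).
Proof.
exists `|c|; split=> // w w' e _ _ e0 _.
by rewrite subrr normr0 mulr_ge0.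
Qed.

Lemma bounded_lipD g h :
  bounded_lip g -> bounded_lip h -> bounded_lip (fun w => g w + h w).
Proof.
move=> [C [C0 g1 g2]] [C' [C'0 h1 h2]]; exists (C + C').
split=> [|w Dw|w w' e Dw Dw' e0 ne]; first exact: addr_ge0.
  by apply: le_trans (ler_normD _ _) (lerD (g1 w Dw) (h1 w Dw)).
rewrite opprD addrACA mulrDl.
by apply: le_trans (ler_normD _ _) (lerD (g2 _ _ _ Dw Dw' e0 ne) (h2 _ _ _ Dw Dw' e0 ne)).
Qed.

Lemma bounded_lipM g h :
  bounded_lip g -> bounded_lip h -> bounded_lip (fun w => g w * h w).
Proof.
move=> [C [C0 g1 g2]] [C' [C'0 h1 h2]]; exists (C * C' *+ 2).
split=> [|w Dw|w w' e Dw Dw' e0 ne].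
- by rewrite mulrn_wge0 // mulr_ge0.
- rewrite normrM mulr2n; apply: le_trans (ler_pM _ _ (g1 w Dw) (h1 w Dw)) _ => //.
  by rewrite lerDl mulr_ge0.
have -> : g w * h w - g w' * h w' = g w * (h w - h w') + (g w - g w') * h w' by ring.
apply: le_trans (ler_normD _ _) _; rewrite mulr2n [leRHS]mulrDl !normrM lerD //.
  by rewrite -mulrA ler_pM ?g1 ?h2.
by rewrite mulrAC ler_pM ?h1 ?g2.
Qed.

Lemma bounded_lip_sum (T : Type) (s : seq T) (g : T -> W -> R) :
  (forall t, bounded_lip (g t)) -> bounded_lip (fun w => \sum_(t <- s) g t w).
Proof.
move=> gl; elim: s => [|t s IH].
  by apply: bounded_lip_ext (bounded_lip_cst 0) => w _; rewrite big_nil.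
apply: bounded_lip_ext (bounded_lipD (gl t) IH) => w _.
by rewrite big_cons.
Qed.

Variable m : nat.
Implicit Types A B : W -> 'M[R]_m.

Lemma bounded_lip_mx_ext A B :
  (forall w, D w -> A w = B w) -> bounded_lip_mx A -> bounded_lip_mx B.
Proof. by move=> AB Al i j; apply: bounded_lip_ext (Al i j) => w Dw; rewrite AB. Qed.

Lemma bounded_lip_mxD A B :
  bounded_lip_mx A -> bounded_lip_mx B -> bounded_lip_mx (fun w => A w + B w).
Proof.
move=> Al Bl i j; apply: bounded_lip_ext (bounded_lipD (Al i j) (Bl i j)) => w _.
by rewrite mxE.
Qed.

Lemma bounded_lip_mxM A B :
  bounded_lip_mx A -> bounded_lip_mx B -> bounded_lip_mx (fun w => A w *m B w).
Proof.
move=> Al Bl i j.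
apply: bounded_lip_ext (bounded_lip_sum (index_enum 'I_m)
  (fun k => bounded_lipM (Al i k) (Bl k j))) => w _.
by rewrite mxE.
Qed.

Lemma bounded_lip_mx_cst (M : 'M[R]_m) : bounded_lip_mx (fun=> M).
Proof. by move=> i j; exact: bounded_lip_cst. Qed.

Lemma bounded_lip_mxN A : bounded_lip_mx A -> bounded_lip_mx (fun w => - A w).
Proof.
move=> Al; apply: bounded_lip_mx_ext (bounded_lip_mxM (bounded_lip_mx_cst (- 1%:M)) Al).
by move=> w _; rewrite mulNmx mul1mx.
Qed.

End BoundedLipschitz.

(** * Coordinates of a chart *)

Section Chart.
Variables (R : realFieldType) (m n : nat) (I J : nat -> {set 'I_m}).
Local Notation mxseq := (nat -> 'M[R]_m).

(** These entries determine the others: non-pivot columns follow from [d *m G *m d = d], and rows in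
    [J i], the pivot columns of the preceding map, from the chain condition. *)
Definition chart_coords : {set 'I_n * ('I_m * 'I_m)} :=
  [set t : 'I_n * ('I_m * 'I_m) |
     (t.2.1 \in I t.1) || (t.2.1 \notin J t.1) && (t.2.2 \in J t.1.+1)].

Lemma card_chart_coords (r : nat -> nat) :
  (forall i, (i < n)%N -> [/\ I i \subset ~: J i, #|I i| = r i.+1,
                              #|J i| = r i & #|J i.+1| = r i.+1]) ->
  #|chart_coords| = stratum_dim m n r.
Proof.
move=> IJ; rewrite -sum1_card /stratum_dim.
transitivity (\sum_(i < n) \sum_(p | (i, p) \in chart_coords) 1)%N.
  by rewrite pair_big_dep /=; apply: eq_bigl => -[i p].
apply: eq_bigr => i _; have [Ii cI cJ cJ'] := IJ i (ltn_ord i).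
have -> : (\sum_(p | (i, p) \in chart_coords) 1 =
   #|setX (I i) [set: 'I_m] :|: setX (~: (J i :|: I i)) (J i.+1)|)%N.
  rewrite -sum1_card; apply: eq_bigl => -[a b].
  rewrite !inE /= andbT; case: (a \in I i) => //=.
  by rewrite orbF.
rewrite cardsU !cardsX cardsT card_ord cI cJ'.
have -> : setX (I i) [set: 'I_m] :&: setX (~: (J i :|: I i)) (J i.+1) = set0.
  by apply/setP => -[a b]; rewrite !inE /=; case: (a \in I i); rewrite ?orbT ?andbF.
rewrite cards0 subn0 cardsCs setCK cardsU cI cJ card_ord.
have -> : J i :&: I i = set0.
  apply/eqP; rewrite setI_eq0 disjoint_sym disjoints_subset; exact: Ii.
by rewrite cards0 subn0 subnDA; lia.
Qed.

(* The second component is the family of pivot inverses of the first. *)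
Definition in_chart (L : R) (w : mxseq * mxseq) : Prop :=
  [/\ J 0%N = set0,
      forall i, (i < n)%N -> I i \subset ~: J i,
      forall i, (i < n)%N -> pivot_inverse (I i) (J i.+1) (w.1 i) (w.2 i),
      forall i a b, (i < n)%N -> `|w.1 i a b| < L /\ `|w.2 i a b| < L &
      forall i, (i.+1 < n)%N -> w.1 i *m w.1 i.+1 = 0].

Definition coords_close (e : R) (w w' : mxseq * mxseq) : Prop :=
  forall t, t \in chart_coords -> `|w.1 t.1 t.2.1 t.2.2 - w'.1 t.1 t.2.1 t.2.2| <= e.

Variable L : R.
Local Notation lip := (bounded_lip (in_chart L) coords_close).
Local Notation lip_mx := (@bounded_lip_mx _ _ (in_chart L) coords_close m).

Lemma chart_coord_lip (i : 'I_n) a b (u : bool) :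
  (u -> (i, (a, b)) \in chart_coords) -> lip (fun w => u%:R * w.1 i a b).
Proof.
move=> uc; exists (`|L| + 1); split=> [|w Dw|w w' e Dw Dw' e0 ne].
- by rewrite addr_ge0.
- have [_ _ _ /(_ i a b (ltn_ord i))[/ltW le1 _] _] := Dw.
  have := ler_norm L; case: u {uc} => /= lel; rewrite ?mulr0n ?mulr1n ?mul1r ?mul0r ?normr0.
    by rewrite (le_trans le1) // (le_trans lel) // lerDl.
  by rewrite addr_ge0.
rewrite -mulrBr; case: u uc => [/(_ isT)|_] /=; last first.
  by rewrite mulr0n mul0r normr0 mulr_ge0 // addr_ge0.
by rewrite mulr1n mul1r => /ne /= /le_trans; apply; rewrite ler_peMl // lerDr.
Qed.

Lemma chart_rows_lip (i : 'I_n) : lip_mx (fun w => coord_proj R (I i) *m w.1 i).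
Proof.
move=> a b; apply: bounded_lip_ext (@chart_coord_lip i a b (a \in I i) _).
  by move=> w _; rewrite mul_coord_projl.
by rewrite inE /= => ->.
Qed.

Lemma chart_cols_lip (i : 'I_n) :
  lip_mx (fun w => coord_proj R (~: J i) *m w.1 i *m coord_proj R (J i.+1)).
Proof.
move=> a b; apply: bounded_lip_ext (@chart_coord_lip i a b ((a \notin J i) && (b \in J i.+1)) _).
  move=> w _; rewrite mul_coord_projr mul_coord_projl inE mulrA -natrM mulnb.
  by rewrite andbC.
by rewrite inE /= orbC => ->.
Qed.

(** The resolvent identity A^-1 - B^-1 = A^-1 (B - A) B^-1 for blocks extended by zero. Only entries
    of the pivot block are compared, and these are chart coordinates. *)
Lemma pivot_inverse_sub I1 J1 (d d' G G' : 'M[R]_m) :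
  pivot_inverse I1 J1 d G -> pivot_inverse I1 J1 d' G' ->
  G - G' = G *m (coord_proj R I1 *m (d' - d) *m coord_proj R J1) *m G'.
Proof.
move=> [G1 G2 G3 G4 _] [G1' G2' G3' G4' _].
have e1 : G *m (coord_proj R I1 *m d' *m coord_proj R J1) *m G' = G.
  by rewrite -!mulmxA G1' [coord_proj R I1 *m _]mulmxA G3' G2.
have e2 : G *m (coord_proj R I1 *m d *m coord_proj R J1) *m G' = G'.
  by rewrite !mulmxA G2 G4 G1'.
by rewrite mulmxBr mulmxBl mulmxBr mulmxBl e1 e2.
Qed.

Lemma pivot_inverse_lip (i : 'I_n) : lip_mx (fun w => w.2 i).
Proof.
(* The first term bounds the entries; the second comes from the two matrix products of size [m] in
   the resolvent identity. *)
move=> a b; exists (`|L| + m%:R * (m%:R * (`|L| * `|L|))).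
have c0 : 0 <= m%:R * (m%:R * (`|L| * `|L|)) by rewrite !mulr_ge0.
have bL w : in_chart L w -> forall a b, `|w.2 i a b| <= `|L|.
  move=> [_ _ _ + _] c c' => /(_ i c c' (ltn_ord i)) [_ /ltW /le_trans]; apply.
  exact: ler_norm.
split=> [|w Dw|w w' e Dw Dw' e0 ne]; first by rewrite addr_ge0.
  by apply: le_trans (bL w Dw a b) _; rewrite lerDl.
have [_ _ /(_ _ (ltn_ord i)) p _ _] := Dw; have [_ _ /(_ _ (ltn_ord i)) p' _ _] := Dw'.
rewrite mulrDl -[leLHS]add0r lerD ?mulr_ge0 //.
have -> : w.2 i a b - w'.2 i a b = (w.2 i - w'.2 i) a b by rewrite !mxE.
rewrite (pivot_inverse_sub p p') mxE; apply: le_trans (ler_norm_sum _ _ _) _.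
have -> : m%:R * (m%:R * (`|L| * `|L|)) * e = \sum_(k < m) m%:R * (`|L| * e) * `|L|.
  by rewrite sumr_const card_ord -[RHS]mulr_natl; ring.
apply: ler_sum => k _; rewrite normrM ler_pM ?bL //.
rewrite mxE; apply: le_trans (ler_norm_sum _ _ _) _.
have -> : m%:R * (`|L| * e) = \sum_(k < m) `|L| * e.
  by rewrite sumr_const card_ord -[RHS]mulr_natl.
apply: ler_sum => l _; rewrite normrM ler_pM ?bL //.
rewrite mul_coord_projr mul_coord_projl mulrA -natrM mulnb.
case: andP => [[_ lI]|_] /=; last by rewrite mulr0n mul0r normr0.
rewrite mulr1n mul1r !mxE distrC.
by apply: (ne (i, (l, k))); rewrite inE /= lI.
Qed.

(** Off the rows in [J i], [d *m G *m d = d] writes d through its pivot columns, [G] and its pivot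
    rows. For the rows in [J i], let c be the preceding map, H its pivot inverse and p the
    projection onto [J i]: H c p = p and c d = 0 give p d = - H c (1 - p) d, which is Lipschitz by
    induction. *)
Lemma chart_entries_lip i : (i < n)%N -> lip_mx (fun w => w.1 i).
Proof.
elim: i => [|i IH] lti; pose o := Ordinal lti.
all: have offJ : lip_mx (fun w => coord_proj R (~: J o) *m w.1 o).
1,3: apply: bounded_lip_mx_ext (bounded_lip_mxM (chart_cols_lip o)
       (bounded_lip_mxM (pivot_inverse_lip o) (chart_rows_lip o))) => w.
1,2: move=> [_ _ /(_ _ lti) [e1 e2 _ _ e5] _ _].
1,2: rewrite [w.2 o *m _]mulmxA e2 -!mulmxA [coord_proj _ _ *m (w.2 o *m _)]mulmxA e1.
1,2: by rewrite [w.1 o *m (_ *m _)]mulmxA e5.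
- apply: bounded_lip_mx_ext offJ => w [/= -> _ _ _ _].
  by rewrite coord_projC coord_proj0 subr0 mul1mx.
pose o' := Ordinal (ltnW lti).
apply: bounded_lip_mx_ext (bounded_lip_mxD offJ (bounded_lip_mxN
  (bounded_lip_mxM (bounded_lip_mxM (pivot_inverse_lip o') (IH (ltnW lti))) offJ))) => w.
move=> [_ _ /(_ _ (ltnW lti)) [_ _ _ e4 _] _ /(_ _ lti) ch] /=.
have h0 : w.2 i *m w.1 i *m w.1 i.+1 = 0 by rewrite -mulmxA ch mulmx0.
have h1 : w.2 i *m w.1 i *m (coord_proj R (J i.+1) *m w.1 i.+1) =
          coord_proj R (J i.+1) *m w.1 i.+1 by rewrite mulmxA e4.
by rewrite coord_projC mulmxBl mul1mx mulmxBr h0 h1 sub0r opprK subrK.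
Qed.

Lemma chart_projection_inverse_lip :
  exists2 C, 0 < C & forall w w' e, in_chart L w -> in_chart L w' -> 0 <= e ->
    coords_close e w w' ->
    forall (i : 'I_n) a b, `|w.1 i a b - w'.1 i a b| <= C * e.
Proof.
have H (t : 'I_n * ('I_m * 'I_m)) := chart_entries_lip (ltn_ord t.1) t.2.1 t.2.2.
have [C HC] := fin_all_exists H.
have C0 t : 0 <= C t by have [] := HC t.
exists (\sum_t C t + 1); first by rewrite ltr_wpDl ?sumr_ge0.
move=> w w' e Dw Dw' e0 ne i a b; have [_ _ /(_ w w' e Dw Dw' e0 ne)] := HC (i, (a, b)).
move/le_trans; apply; apply: ler_wpM2r => //.
by rewrite (bigD1 (i, (a, b))) //= -addrA lerDl addr_ge0 // sumr_ge0.
Qed.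

End Chart.

(** * Covering the variety by charts *)

Definition rank_seq (F : fieldType) m (d : nat -> 'M[F]_m) (i : nat) : nat :=
  if i is i'.+1 then \rank (d i') else 0%N.

(** Pivots are chosen successively. The pivot rows of each map can avoid the pivot columns of the
    preceding one, because the chain condition makes the rows at those columns combinations of the
    other rows: this is [spanned]. *)
Lemma chain_pivots (F : fieldType) m (d : nat -> 'M[F]_m) :
  (forall i, d i *m d i.+1 = 0) ->
  exists I J : nat -> {set 'I_m}, exists G : nat -> 'M[F]_m,
  [/\ J 0%N = set0, forall i, I i \subset ~: J i, forall i, #|I i| = rank_seq d i.+1,
      forall i, #|J i| = rank_seq d i
    & forall i, pivot_inverse (I i) (J i.+1) (d i) (G i)].
Proof.
move=> ch.
pose spanned i J := exists E, d i = E *m (coord_proj F (~: J) *m d i).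
pose pivot i J (t : {set 'I_m} * {set 'I_m} * 'M[F]_m) :=
  [/\ t.1.1 \subset ~: J, #|t.1.1| = \rank (d i), #|t.1.2| = \rank (d i)
    & pivot_inverse t.1.1 t.1.2 (d i) t.2].
(* A default value where [spanned] fails lets [J] be defined by recursion before [spanned] is proved
   along it. *)
have /choice[f fP] : forall x : nat * {set 'I_m},
    exists t, spanned x.1 x.2 -> pivot x.1 x.2 t.
  move=> [i J] /=.
  have [[E dE]|nsp] := pselect (spanned i J); last by exists (set0, set0, 0).
  by have [I [J' [G HG]]] := pivot_exists dE; exists (I, J', G).
pose J := fix J i := if i is i'.+1 then (f (i', J i')).1.2 else set0.
have sp i : spanned i (J i).
  elim: i => [|i IH].
    by exists 1%:M; rewrite coord_projC coord_proj0 subr0 !mul1mx.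
  have [_ _ _ [_ _ _ e4 _]] := fP (i, J i) IH; set G := (f (i, J i)).2 in e4.
  (* With p the projection onto [J i.+1], (1 - G d_i)(1 - p) d_{i+1} = d_{i+1}, since d_i d_{i+1} =
     0 and G d_i p = p. *)
  exists (1%:M - G *m d i); rewrite coord_projC mulmxBl mul1mx.
  rewrite mulmxBl mul1mx mulmxBr -[_ *m d i *m d i.+1]mulmxA ch mulmx0 sub0r opprK.
  by rewrite mulmxA e4 subrK.
exists (fun i => (f (i, J i)).1.1), J, (fun i => (f (i, J i)).2); split=> // i.
- by have [] := fP (i, J i) (sp i).
- by have [] := fP (i, J i) (sp i).
- case: i => [|i] /=; first by rewrite cards0.
  by have [] := fP (i, J i) (sp i).
- by have [] := fP (i, J i) (sp i).
Qed.

Lemma ler_sum_term (R : numDomainType) (T : finType) (g : T -> R) (t : T) :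
  (forall u, 0 <= g u) -> g t <= \sum_u g u.
Proof. by move=> g0; rewrite (bigD1 t) //= lerDl sumr_ge0. Qed.

(** Finite sequences of pivot sets and a natural bound make the charts a countable family. *)
Lemma chart_cover (R : archiRealFieldType) m n (d : nat -> 'M[R]_m) :
  (forall i, d i *m d i.+1 = 0) ->
  exists (sI sJ : seq {set 'I_m}) (L : nat) (G : nat -> 'M[R]_m),
    in_chart n (nth set0 sI) (nth set0 sJ) L%:R (d, G) /\
    #|chart_coords n (nth set0 sI) (nth set0 sJ)| = stratum_dim m n (rank_seq d).
Proof.
move=> ch; have [I [J [G [J0 IJ cI cJ piv]]]] := chain_pivots ch.
pose S := \sum_(i < n) \sum_(a < m) \sum_(b < m) (`|d i a b| + `|G i a b|).
have SP (i : nat) a b : (i < n)%N -> `|d i a b| + `|G i a b| <= S.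
  move=> lti.
  have F0 j a' b' : 0 <= `|d j a' b'| + `|G j a' b'| by rewrite addr_ge0.
  have S1 j a' := ler_sum_term (g := fun b' => `|d j a' b'| + `|G j a' b'|) b (F0 j a').
  have S20 j a' : 0 <= \sum_(b' < m) (`|d j a' b'| + `|G j a' b'|) by apply: sumr_ge0.
  have S2 j := ler_sum_term (g := fun a' => \sum_(b' < m) (`|d j a' b'| + `|G j a' b'|)) a (S20 j).
  have S30 (j : 'I_n) : 0 <= \sum_(a' < m) \sum_(b' < m) (`|d j a' b'| + `|G j a' b'|).
    by apply: sumr_ge0.
  by apply: le_trans (ler_sum_term (Ordinal lti) S30); apply: le_trans (S2 i); exact: S1.
(* The pivot columns of the last map are [J n], hence the extra term; the bound exceeds [S], which
   dominates every entry. *)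
exists (mkseq I n), (mkseq J n.+1), (Num.truncn S).+1, G.
have nI i : (i < n)%N -> nth set0 (mkseq I n) i = I i by move=> ?; rewrite nth_mkseq.
have nJ i : (i <= n)%N -> nth set0 (mkseq J n.+1) i = J i by move=> ?; rewrite nth_mkseq.
split.
  split=> [|i lti|i lti|i a b lti|i lti].
  - by rewrite -J0.
  - by rewrite nI // nJ // ltnW.
  - by rewrite nI // (nJ i.+1).
  - have := SP i a b lti; have := truncnS_gt S.
    have := normr_ge0 (d i a b); have := normr_ge0 (G i a b); split; lra.
  - exact: ch.
apply: card_chart_coords => i lti.
by rewrite nI // !nJ // ?(ltnW lti) //; split.
Qed.

(** * Complexes with prescribed chart coordinates *)

Lemma diag_dominant_unit (R : realFieldType) m (W : 'M[R]_m) :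
  (forall a, \sum_(b | b != a) `|W b a| < `|W a a|) -> W \in unitmx.
Proof.
move=> dom; rewrite unitmxE unitfE; apply/negP => /det0P[v v0 vW].
have [i0 vi0] : exists i, v 0 i != 0 by apply/rV0Pn.
(* At a largest entry of a left kernel vector, the column equation contradicts dominance. *)
case: (@Order.TotalTheory.arg_maxP _ _ _ i0 xpredT (fun i => `|v 0 i|) isT) => a _ amax.
have va : 0 < `|v 0 a| by apply: lt_le_trans (amax i0 isT); rewrite normr_gt0.
have : v 0 a * W a a = - \sum_(b | b != a) v 0 b * W b a.
  move/matrixP: vW => /(_ 0 a); rewrite !mxE (bigD1 a) //= => /eqP.
  by rewrite addr_eq0 => /eqP.
move/(congr1 Num.norm); rewrite normrN normrM => e.
have : `|v 0 a| * `|W a a| <= `|v 0 a| * \sum_(b | b != a) `|W b a|.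
  rewrite e mulr_sumr; apply: le_trans (ler_norm_sum _ _ _) _.
  by apply: ler_sum => b _; rewrite normrM ler_wpM2r //; exact: (amax b).
by rewrite ler_pM2l // leNgt dom.
Qed.

(** Diagonal entries are at least m + 1 and the others lie in [0, 1], so every principal block is
    strictly dominant. [W] completes the block by the identity off [P], which makes a full-size
    inverse available. *)
Lemma dominant_block_inverse (R : realFieldType) m (P : {set 'I_m}) (X : 'M[R]_m) :
  (forall a b, (m.+1 * (a == b))%:R <= X a b <= (m.+1 * (a == b))%:R + 1) ->
  exists G, [/\ coord_proj R P *m G = G, G *m coord_proj R P = G,
    coord_proj R P *m X *m G = coord_proj R P & G *m X *m coord_proj R P = coord_proj R P].
Proof.
move=> Xb; set p := coord_proj R P; pose W := p *m X *m p + (1%:M - p).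
have pp : p *m p = p by exact: coord_proj_id.
have pW : p *m W = p *m X *m p by rewrite /W mulmxDr mulmxBr mulmx1 pp subrr addr0 !mulmxA pp.
have Wp : W *m p = p *m X *m p by rewrite /W mulmxDl mulmxBl mul1mx pp subrr addr0 -!mulmxA pp.
have Wu : W \in unitmx.
  apply: diag_dominant_unit => a.
  have WE b c : W b c = ((b \in P) && (c \in P))%:R * X b c + ((b == c) && (b \notin P))%:R.
    rewrite mxE mul_coord_projr mul_coord_projl mulrA -natrM mulnb andbC -coord_projC.
    by rewrite coord_projE inE.
  have [aP|aP] := boolP (a \in P).
    have /andP[Xa _] := Xb a a; rewrite WE aP eqxx /= mul1r addr0.
    apply: (@lt_le_trans _ _ m.+1%:R); last first.
      by rewrite eqxx muln1 in Xa; apply: le_trans Xa (ler_norm _).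
    apply: (@le_lt_trans _ _ (\sum_(b < m | b != a) 1)); last first.
      rewrite sumr_const ltr_nat ltnS; apply: leq_trans (max_card _) _.
      by rewrite card_ord.
    apply: ler_sum => b ba; rewrite WE (negbTE ba) aP andbT /= addr0.
    have := Xb b a; rewrite (negbTE ba) muln0 add0r => /andP[x0 x1].
    by case: (b \in P); rewrite /= ?mul1r ?mul0r ?normr0 // ger0_norm.
  rewrite WE (negbTE aP) eqxx /= mul0r add0r normr1 big1 // => b ba.
  by rewrite WE (negbTE ba) (negbTE aP) andbF /= mul0r addr0 normr0.
have pV : p *m invmx W = invmx W *m p.
  have : invmx W *m (W *m p) *m invmx W = invmx W *m (p *m W) *m invmx W by rewrite pW Wp.
  by rewrite !mulmxA mulVmx // mul1mx -!mulmxA mulmxV // mulmx1.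
exists (p *m invmx W *m p); split.
- by rewrite !mulmxA pp.
- by rewrite -!mulmxA pp.
- by rewrite !mulmxA -pW -[p *m W *m _]mulmxA mulmxV // mulmx1 pp.
- rewrite pV -[_ *m p *m p]mulmxA pp -!mulmxA [p *m (X *m p)]mulmxA -Wp.
  by rewrite mulmxA mulVmx // mul1mx.
Qed.

Lemma chart_realize (R : realFieldType) m n (J : nat -> {set 'I_m}) (X : nat -> 'M[R]_m) :
  J 0%N = set0 -> (forall i, J i.+1 \subset ~: J i) ->
  (forall i a b, (m.+1 * (a == b))%:R <= X i a b <= (m.+1 * (a == b))%:R + 1) ->
  exists d : nat -> 'M[R]_m, (forall i, d i *m d i.+1 = 0) /\
    forall t, t \in chart_coords n (fun i => J i.+1) J -> d t.1 t.2.1 t.2.2 = X t.1 t.2.1 t.2.2.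
Proof.
move=> J0 JJ Xb.
have [G GP] := choice (fun i => dominant_block_inverse (J i.+1) (Xb i)).
pose q i := coord_proj R (~: J i).
(* [Y i] agrees with [X i] on the chart coordinates, vanishes on the rows in [J i], and has no rank
   beyond the pivot block. *)
pose Y i := q i *m X i *m G i *m X i.
(* The left factor changes only the rows in [J i], and it kills the composite because d - d G d = 0
   for the preceding map. *)
pose d := fix d i := if i is i'.+1 then (1%:M - G i' *m d i') *m Y i else Y 0%N.
have qq i : q i *m q i = q i by exact: coord_proj_id.
have qY i : q i *m Y i = Y i by rewrite /Y !mulmxA qq.
have qd i : q i *m d i = Y i.
  case: i => [|i] /=; first exact: qY.
  have [e1 _ _ _] := GP i.
  have qG : q i.+1 *m G i = 0 by rewrite /q coord_projC mulmxBl mul1mx e1 subrr.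
  by rewrite mulmxA mulmxBr mulmx1 [q i.+1 *m (G i *m _)]mulmxA qG mul0mx subr0 qY.
have pq i : coord_proj R (J i.+1) *m q i = coord_proj R (J i.+1).
  by rewrite coord_proj_setI (setIidPl (JJ i)).
have pd i : coord_proj R (J i.+1) *m d i = coord_proj R (J i.+1) *m X i.
  have [_ _ e3 _] := GP i.
  by rewrite -{1}pq -mulmxA qd /Y !mulmxA pq e3.
have GXG i : G i *m X i *m G i = G i.
  have [e1 _ _ e4] := GP i.
  by rewrite -{2}e1 mulmxA e4.
have YGX i : Y i *m (G i *m X i) = Y i.
  transitivity (q i *m X i *m (G i *m X i *m G i) *m X i); first by rewrite !mulmxA.
  by rewrite GXG.
have Gd i : G i *m d i = G i *m X i.
  by have [_ e2 _ _] := GP i; rewrite -{1}e2 -mulmxA pd mulmxA e2.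
have dGd i : d i *m (G i *m d i) = d i.
  rewrite Gd; case: i => [|i] /=; first exact: YGX.
  by rewrite -mulmxA YGX.
exists d; split=> [i|[i [a b]]] /=.
  by rewrite mulmxA mulmxBr mulmx1 dGd subrr mul0mx.
rewrite inE /= => /orP[aI|/andP[aJ bJ]].
  move/matrixP: (pd i) => /(_ a b); rewrite !mul_coord_projl aI !mul1r; exact.
have : q i *m d i *m coord_proj R (J i.+1) = q i *m X i *m coord_proj R (J i.+1).
  have [_ _ _ e4] := GP i.
  by rewrite qd /Y -!mulmxA [G i *m _]mulmxA e4.
move/matrixP/(_ a b); rewrite !mul_coord_projr !mul_coord_projl bJ inE aJ !mul1r; exact.
Qed.

(** Initial segments in odd degrees and final ones in even degrees: neighbours are disjoint since
    [r i + r i.+1 <= m]. *)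
Lemma block_sets m n (r : nat -> nat) : rank_vector m n r ->
  exists J : nat -> {set 'I_m}, [/\ J 0%N = set0, forall i, J i.+1 \subset ~: J i &
    #|chart_coords n (fun i => J i.+1) J| = stratum_dim m n r].
Proof.
move=> [r0 rn rm].
have r_le i : (i <= n)%N -> (r i <= m)%N by move=> /rm; lia.
pose J i : {set 'I_m} := if (i <= n)%N then
   (if odd i then [set a : 'I_m | (a < r i)%N] else [set a : 'I_m | (m - r i <= a)%N]) else set0.
have cJ i : (i <= n)%N -> #|J i| = r i.
  move=> lei; rewrite /J lei.
  have lo k : (k <= m)%N -> #|[set a : 'I_m | (a < k)%N]| = k.
    move=> km; rewrite -sum1_card (eq_bigl (fun a : 'I_m => a < k)%N) => [|a].
      by rewrite -(big_ord_widen m (fun=> 1%N) km) sum1_card card_ord.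
    by rewrite inE.
  case: ifP => _; first exact/lo/r_le.
  have -> : [set a : 'I_m | (m - r i <= a)%N] = ~: [set a : 'I_m | (a < m - r i)%N].
    by apply/setP => a; rewrite !inE -leqNgt.
  rewrite cardsCs setCK lo ?leq_subr // card_ord; have := r_le i lei; lia.
have J0 : J 0%N = set0 by apply/eqP; rewrite -cards_eq0 cJ // r0.
have JJ i : J i.+1 \subset ~: J i.
  rewrite /J; case: ltnP => [lti|_]; last exact: sub0set.
  rewrite (ltnW lti) /=; apply/subsetP => a; have := rm i (ltnW lti).
  by have := ltn_ord a; case: (odd i) => /=; rewrite !inE; lia.
exists J; split=> //; apply: card_chart_coords => i lti.
by rewrite !cJ // ltnW.
Qed.

From mathcomp Require Import all_classical all_reals all_analysis.
From mathcomp Require Import measurable_realfun.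
Import numFieldNormedType.Exports.
Local Open Scope classical_set_scope.
Local Open Scope ring_scope.

(** * Hausdorff measure *)

(* Induction on the dimension: the boxes meeting the slice at [t] cover it, and
   integrating over [t] in [0, 1] multiplies each weight by at most its side. *)
Lemma box_cover_volume (R : realType) (K : nat) :
  forall (J : nat -> bool) (c : nat -> nat -> R) (l : nat -> R),
  (forall j, 0 <= l j) ->
  (forall x : nat -> R, (forall i, (i < K)%N -> 0 <= x i <= 1) ->
     exists j, J j /\ forall i, (i < K)%N -> c j i <= x i <= c j i + l j) ->
  (1 <= \sum_(j <oo) ((J j)%:R * l j ^+ K)%:E)%E.
Proof.
elim: K => [|K IH] J c l l0 cov.
  have [j [Jj _]] := cov (fun=> 0) (fun i => ltac:(by [])).
  have pos i : (0 <= ((J i)%:R * l i ^+ 0)%:E)%E.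
    by rewrite lee_fin mulr_ge0 // ?exprn_ge0.
  apply: le_trans (nneseries_lim_ge j.+1 _); last by move=> i _ _; apply: pos.
  rewrite big_nat_recr //= Jj expr0 mulr1.
  by apply: leeDr; apply: sume_ge0 => i _; exact: pos.
pose D : set (measurableTypeR R) := `[0%R, 1%R]%classic.
pose I j : set (measurableTypeR R) := `[c j 0%N, c j 0%N + l j]%classic.
pose g j (t : measurableTypeR R) : \bar R := (((J j)%:R * l j ^+ K) * \1_(I j) t)%:E.
have mD : measurable D by exact: measurable_itv.
have mI j : measurable (I j) by exact: measurable_itv.
have w0 j : 0 <= (J j)%:R * l j ^+ K by rewrite mulr_ge0 // exprn_ge0.
have g0 j t : (0 <= g j t)%E by rewrite lee_fin mulr_ge0.
have mg j : measurable_fun D (g j).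
  apply/measurable_EFinP; apply: measurable_funM; first exact: measurable_cst.
  exact: measurable_indic.
have slice t : D t -> (1 <= \sum_(j <oo) g j t)%E.
  rewrite /D /= in_itv /= => t01.
  (* The mask selects the boxes meeting the slice without reindexing the family. *)
  pose J' j := J j && (t \in I j).
  have := IH J' (fun j i => c j i.+1) l l0; rewrite /J'.
  have -> : (\sum_(j <oo) ((J j && (t \in I j))%:R * l j ^+ K)%:E =
             \sum_(j <oo) g j t)%E.
    apply: eq_eseriesr => j _; rewrite /g indicE.
    by case: (J j); case: (t \in I j); rewrite /= ?mulr1n ?mulr0n ?(mul1r, mul0r, mulr1, mulr0).
  apply=> x x01; have [|j [Jj cj]] := cov (fun i => if i is i'.+1 then x i' else t).
    by case=> [|i] //= /x01.
  exists j; split => [|i iK]; last by have := cj i.+1 iK.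
  by rewrite Jj /= inE /I /= in_itv /=; exact: (cj 0%N).
have mu01 : lebesgue_measure D = 1%E.
  by rewrite /D lebesgue_measure_itv /= lte_fin ltr01 oppr0 adde0.
have : (\int[lebesgue_measure]_(t in D) (cst 1 t) <=
        \int[lebesgue_measure]_(t in D) (\sum_(j <oo) g j t))%E.
  apply: ge0_le_integral => //.
  by apply: ge0_emeasurable_sum => // k t _ _; exact: g0.
rewrite integral_cst //= mul1e mu01 (integral_nneseries lebesgue_measure mD mg (fun k t _ => g0 k t)).
move/le_trans; apply; apply: lee_nneseries => [j _|j _].
  by move=> _; apply: integral_ge0 => t _; exact: g0.
rewrite /g; under eq_integral do rewrite EFinM.
rewrite ge0_integralZl ?lee_fin //; last first.
  by apply/measurable_EFinP; exact: measurable_indic.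
rewrite integral_indic // exprSr mulrA [leRHS]EFinM; apply: lee_pmul; rewrite ?lee_fin //.
apply: (@le_trans _ _ (lebesgue_measure (I j))).
  by apply: le_measure; rewrite ?inE //; exact: measurableI.
rewrite /I lebesgue_measure_itv /= lte_fin; case: ifP => _; last by rewrite lee_fin.
by rewrite -EFinB lee_fin addrAC subrr add0r.
Qed.

(** Merges countably many countable covers into one, along a bijection of [nat] with pairs. *)
Lemma double_sequence_sum (R : realType) (T : Type) (U : nat -> nat -> T) (h : T -> \bar R) :
  (forall t, 0 <= h t)%E ->
  exists V : nat -> T, [/\ forall l j, exists k, V k = U l j, forall k, exists l j, V k = U l j &
    (\sum_(k <oo) h (V k) = \sum_(l <oo) \sum_(j <oo) h (U l j))%E].
Proof.
move=> h0; have /card_esym/ppcard_eqP[f] := card_nat2.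
exists (fun k => U (f k).1 (f k).2); split.
- by move=> l j; exists (f^-1%FUN (l, j)); rewrite invK ?inE.
- by move=> k; exists (f k).1, (f k).2.
rewrite nneseries_esumT // (eq_eseriesr (g := fun l => \esum_(j in [set: nat]) h (U l j))%E);
  last by move=> l _; rewrite nneseries_esumT.
rewrite nneseries_esumT; last by move=> l; apply: esum_ge0.
rewrite esum_esum //.
rewrite (reindex_esum [set: nat] _ f) //.
rewrite (_ : _ `*`` _ = [set: nat * nat]); first exact: 'bij_f.
by apply/seteqP; split.
Qed.

Lemma nneseries_eventually0 (R : realType) (u : nat -> \bar R) (N : nat) :
  (forall j, 0 <= u j)%E -> (forall j, (N <= j)%N -> u j = 0%E) ->
  (\sum_(j <oo) u j = \sum_(j < N) u j)%E.
Proof.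
move=> u0 uN; rewrite (nneseries_split 0 N) // add0n eseries0 ?adde0 ?big_mkord //.
by move=> j /uN.
Qed.

Section Hausdorff.
Variables (R : realType) (a : nat -> nat) (n : nat).
Implicit Types (A B M Y Z : set (chpt R a n)) (x y z : chpt R a n).

Lemma cdistxx x : cdist x x = 0.
Proof.
rewrite /cdist big1 ?sqrtr0 // => i _; rewrite big1 // => r _; rewrite big1 // => c _.
by rewrite subrr expr0n.
Qed.

Lemma cdist_ge0 x y : 0 <= cdist x y.
Proof. exact: sqrtr_ge0. Qed.

Lemma cdist_entry x y i r c : `|x i r c - y i r c| <= cdist x y.
Proof.
rewrite -sqrtr_sqr; apply: ler_wsqrtr.
rewrite (bigD1 i) //= (bigD1 r) //= (bigD1 c) //= -!addrA lerDl.
by rewrite !addr_ge0 // ?sumr_ge0 // => *; rewrite ?sumr_ge0 // => *;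
  rewrite ?sqr_ge0 ?sumr_ge0 // => *; rewrite sqr_ge0.
Qed.

(** Entrywise (y - z)^2 <= 2 (x - y)^2 + 2 (x - z)^2, which avoids Minkowski's inequality. *)
Lemma cdist_ball x y z e : cdist x y < e -> cdist x z < e -> cdist y z <= 2 * e.
Proof.
move=> xy xz; have e0 : 0 <= e by apply: le_trans (ltW xy); exact: cdist_ge0.
rewrite -[leRHS]ger0_norm ?mulr_ge0 // -sqrtr_sqr; apply: ler_wsqrtr.
have sq u v : cdist u v < e ->
    \sum_(i < n) \sum_(r < a i) \sum_(c < a i.+1) (u i r c - v i r c) ^+ 2 <= e ^+ 2.
  move=> uv; rewrite -[leLHS]sqr_sqrtr; first by rewrite ler_sqr ?nnegrE ?sqrtr_ge0 // ltW.
  by do 3 (apply: sumr_ge0 => ? _); exact: sqr_ge0.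
have -> : (2 * e) ^+ 2 = (2 * e ^+ 2) + (2 * e ^+ 2) by ring.
apply: (@le_trans _ _ (2 * (\sum_(i < n) \sum_(r < a i) \sum_(c < a i.+1) (x i r c - y i r c) ^+ 2)
  + 2 * (\sum_(i < n) \sum_(r < a i) \sum_(c < a i.+1) (x i r c - z i r c) ^+ 2))); last first.
  by rewrite lerD // ler_pM2l // sq.
rewrite !mulr_sumr -big_split; apply: ler_sum => i _ /=.
rewrite !mulr_sumr -big_split; apply: ler_sum => r _ /=.
rewrite !mulr_sumr -big_split; apply: ler_sum => c _ /=.
by have := sqr_ge0 ((x i r c - y i r c) + (x i r c - z i r c)); lra.
Qed.

Lemma cdist_le_entries x y e : 0 <= e ->
  (forall i r c, `|x i r c - y i r c| <= e) ->
  cdist x y <= (\sum_(i < n) \sum_(r < a i) \sum_(c < a i.+1) 1 + 1) * e.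
Proof.
move=> e0 xy; set S := \sum_(i < n) _.
have S0 : 0 <= S by do 3 (apply: sumr_ge0 => ? _).
rewrite -[leRHS]ger0_norm ?mulr_ge0 ?addr_ge0 // -sqrtr_sqr; apply: ler_wsqrtr.
apply: (@le_trans _ _ (S * e ^+ 2)).
  rewrite mulr_suml; apply: ler_sum => i _; rewrite mulr_suml; apply: ler_sum => r _.
  rewrite mulr_suml; apply: ler_sum => c _; rewrite mul1r.
  by rewrite -real_normK ?num_real // ler_sqr ?nnegrE.
rewrite exprMn; apply: ler_wpM2r; first exact: sqr_ge0.
by nra.
Qed.

Lemma cdiam_ge0 A : A !=set0 -> (0 <= cdiam A)%E.
Proof. by move=> [x Ax]; apply: ereal_sup_ubound; exists x, x; rewrite cdistxx. Qed.

Lemma cdiam_fin A (d : R) : A !=set0 -> (cdiam A <= d%:E)%E ->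
  [/\ cdiam A = (fine (cdiam A))%:E, 0 <= fine (cdiam A) & fine (cdiam A) <= d].
Proof.
move=> A0 Ad; have c0 := cdiam_ge0 A0.
have fin : cdiam A \is a fin_num.
  by rewrite ge0_fin_numE // (le_lt_trans Ad) // ltry.
by split; rewrite ?fineK // ?fine_ge0 // -lee_fin fineK.
Qed.

Lemma cdiam_cball x e : (cdiam (cball x e) <= (2 * e)%:E)%E.
Proof.
by apply: ge_ereal_sup => _ [y [z [xy [xz ->]]]]; rewrite lee_fin (cdist_ball xy xz).
Qed.

Lemma hterm_ge0 s A : (0 <= hterm s A)%E.
Proof. by rewrite /hterm; case: asboolP => // _; rewrite lee_fin powR_ge0. Qed.

Lemma hterm0 s : hterm s (set0 : set (chpt R a n)) = 0%E.
Proof. by rewrite /hterm; case: asboolP => // -[]. Qed.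

Lemma powR_le_expr (d s : R) (p : nat) : (0 < p)%N -> 0 <= d <= 1 -> p%:R <= s ->
  d `^ s <= d ^+ p.
Proof.
move=> p0 /andP[d0 d1] ps; rewrite -powR_mulrn //.
move: d0; rewrite le_eqVlt => /predU1P[<-|d0]; last by apply: ger_powR => //; rewrite d0.
rewrite !powR0 //; first by rewrite pnatr_eq0 -lt0n.
by rewrite gt_eqF // (lt_le_trans _ ps) // ltr0n.
Qed.

Lemma hterm_cball (s : R) (p : nat) x e : (0 < p)%N -> p%:R <= s -> 0 <= e -> 2 * e <= 1 ->
  (hterm s (cball x e) <= (2 ^+ p * e ^+ p)%:E)%E.
Proof.
move=> p0 ps e0 e1; rewrite /hterm; case: asboolP => [ne|_]; last first.
  by rewrite lee_fin mulr_ge0 ?exprn_ge0.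
have [_ d0 de] := cdiam_fin ne (cdiam_cball x e).
rewrite lee_fin -exprMn; apply: le_trans (powR_le_expr p0 _ ps) _.
  by rewrite d0 (le_trans de).
by rewrite lerXn2r ?nnegrE // mulr_ge0.
Qed.

(** No bound on the radii is imposed: for [0 < p] a small sum forces every radius to be small, so
    these covers serve at every scale. Radius 0 gives an empty ball. *)
Definition ball_null (p : nat) A : Prop := forall e : R, 0 < e ->
  exists (x : nat -> chpt R a n) (r : nat -> R),
    [/\ forall j, 0 <= r j, A `<=` \bigcup_j cball (x j) (r j)
      & (\sum_(j <oo) (r j ^+ p)%:E <= e%:E)%E].

Lemma ball_null_subset p A B : A `<=` B -> ball_null p B -> ball_null p A.
Proof.
move=> AB nB e e0; have [x [r [r0 cov sm]]] := nB e e0.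
by exists x, r; split=> //; apply: subset_trans AB cov.
Qed.

Lemma ball_null_bigcup p (A : nat -> set (chpt R a n)) :
  (forall l, ball_null p (A l)) -> ball_null p (\bigcup_l A l).
Proof.
move=> nA e e0.
have /choice[c cP] : forall l, exists c : nat -> chpt R a n * R,
   [/\ forall j, 0 <= (c j).2, A l `<=` \bigcup_j cball (c j).1 (c j).2
     & (\sum_(j <oo) ((c j).2 ^+ p)%:E <= (e / (2 ^ l.+1)%:R)%:E)%E].
  move=> l; have [|x [r [r0 cov sm]]] := nA l (e / (2 ^ l.+1)%:R).
    by rewrite divr_gt0 // ltr0n expn_gt0.
  by exists (fun j => (x j, r j)).
have [V [VU _ Vs]] := @double_sequence_sum R _ c
   (fun t => (`|t.2| ^+ p)%:E) (fun t => ltac:(by rewrite lee_fin exprn_ge0)).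
exists (fun k => (V k).1), (fun k => `|(V k).2|); split=> //.
  move=> x [l _ Ax]; have [r0 /(_ _ Ax)[j _ xj] _] := cP l.
  by have [k Vk] := VU l j; exists k => //; rewrite Vk ger0_norm.
rewrite Vs; apply: le_trans (epsilon_trick0 xpredT (ltW e0)).
apply: lee_nneseries => l _.
  by move=> _; apply: nneseries_ge0 => j _ _; rewrite lee_fin exprn_ge0.
have [r0 _] := cP l; apply: le_trans.
by apply: lee_nneseries => j _; rewrite ?lee_fin ?exprn_ge0 // ger0_norm.
Qed.

Lemma cborel_cball x e : 0 <= e -> cborel (cball x e).
Proof.
rewrite le_eqVlt => /predU1P[<-|e0]; last by apply: sub_sigma_algebra; exists x, e.
rewrite (_ : cball x 0 = set0); first exact: sigma_algebra0.
by apply/seteqP; split=> // y; rewrite /cball /= ltNge cdist_ge0.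
Qed.

Lemma cborel_bigcup (A : nat -> set (chpt R a n)) :
  (forall j, cborel (A j)) -> cborel (\bigcup_j A j).
Proof. exact: sigma_algebra_bigcup. Qed.

Lemma cborelC A : cborel A -> cborel (~` A).
Proof. by move=> bA; rewrite -setTD; exact: sigma_algebraCD. Qed.

Lemma cborelD A B : cborel A -> cborel B -> cborel (A `\` B).
Proof.
move=> bA bB; rewrite -[_ `\` _]setCK; apply: cborelC.
rewrite setDE setCI setCK -bigcup2E; apply: cborel_bigcup => -[|[|j]] //=.
  exact: cborelC.
exact: sigma_algebra0.
Qed.

(* Spares any measurability argument for the rank conditions. *)
Lemma ball_null_borel p A : ball_null p A ->
  exists Z, [/\ cborel Z, A `<=` Z & ball_null p Z].
Proof.
move=> nA.
have /choice[c cP] : forall k : nat, exists c : nat -> chpt R a n * R,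
   [/\ forall j, 0 <= (c j).2, A `<=` \bigcup_j cball (c j).1 (c j).2
     & (\sum_(j <oo) ((c j).2 ^+ p)%:E <= (k.+1%:R^-1)%:E)%E].
  move=> k; have [|x [r [r0 cov sm]]] := nA k.+1%:R^-1; first by rewrite invr_gt0.
  by exists (fun j => (x j, r j)).
(* A G-delta set: the intersection of open covers with sums at most 1/(k+1). *)
exists (\bigcap_k \bigcup_j cball (c k j).1 (c k j).2); split.
- rewrite -[\bigcap_k _]setCK setC_bigcap; apply: cborelC; apply: cborel_bigcup => k.
  apply: cborelC; apply: cborel_bigcup => j; apply: cborel_cball.
  by have [] := cP k.
- by move=> x Ax k _; have [_ + _] := cP k; exact.
move=> e e0; pose k := Num.truncn e^-1.
have [r0 _ sm] := cP k.
exists (fun j => (c k j).1), (fun j => (c k j).2); split=> //.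
  by move=> x; exact.
apply: le_trans sm _; rewrite lee_fin -[leRHS]invrK lef_pV2 ?posrE ?invr_gt0 //.
by rewrite ltW // truncnS_gt.
Qed.

Lemma hausdorff_delta_ge0 s d A : (0 <= hausdorff_delta s d A)%E.
Proof.
apply: le_ereal_inf_tmp => _ [U [_ [_ ->]]]; apply: nneseries_ge0 => j _ _; exact: hterm_ge0.
Qed.

Lemma hausdorff_delta_le s d A : 0 < d -> (hausdorff_delta s d A <= hausdorff s A)%E.
Proof. by move=> d0; apply: ereal_sup_ubound; exists d. Qed.

Lemma hausdorff_ge0 s A : (0 <= hausdorff s A)%E.
Proof. exact: le_trans (hausdorff_delta_ge0 s 1 A) (hausdorff_delta_le s A ltr01). Qed.

Lemma cdiam0 : cdiam (set0 : set (chpt R a n)) = -oo%E.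
Proof.
rewrite /cdiam (_ : [set z | _] = set0) ?ereal_sup0 //.
by apply/seteqP; split=> // z [x [y []]].
Qed.

Lemma hausdorff_set0 s : hausdorff s (set0 : set (chpt R a n)) = 0%E.
Proof.
apply/eqP; rewrite eq_le hausdorff_ge0 andbT.
apply: ge_ereal_sup => _ [d [_ ->]]; apply: ereal_inf_lbound.
exists (fun=> set0); split=> //; split=> [j|]; first by rewrite cdiam0 leNye.
by rewrite eseries0 // => j _ _; rewrite hterm0.
Qed.

(** A fine cover of [A] together with small balls covering [Z] is a fine cover of the union, at
    arbitrarily small extra cost. *)
Lemma hausdorff_setU_null (s : R) (p : nat) A Z : (0 < p)%N -> p%:R <= s ->
  ball_null p Z -> (hausdorff s (A `|` Z) <= hausdorff s A)%E.
Proof.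
move=> p0 ps nZ; apply: ge_ereal_sup => _ [d [d0 ->]].
apply: le_trans (hausdorff_delta_le s A d0).
apply: le_ereal_inf_tmp => _ [U [AU [Ud ->]]].
apply/lee_addgt0Pr => e e0.
(* A sum of at most rho^p keeps each radius at most [rho], hence each diameter at most [d] and 1;
   the latter allows the exponent [p] in place of [s]. The second bound in [e'] absorbs the factor
   2^p of [hterm_cball]. *)
pose rho := Num.min d 1 / 2.
have rho0 : 0 < rho by rewrite divr_gt0 // lt_min d0 ltr01.
pose e' := Num.min (rho ^+ p) (e / 2 ^+ p).
have e'0 : 0 < e' by rewrite lt_min exprn_gt0 // divr_gt0 // exprn_gt0.
have [x [r [r0 cov sm]]] := nZ e' e'0.
have rrho j : 2 * r j <= Num.min d 1.
  suff : r j <= rho by rewrite /rho; lra.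
  rewrite -(@ler_pXn2r _ p) ?nnegrE ?(ltW rho0) //.
  rewrite -lee_fin; apply: (@le_trans _ _ e'%:E); last by rewrite lee_fin ge_min lexx.
  apply: le_trans sm; apply: le_trans (nneseries_lim_ge j.+1 _); last first.
    by move=> i _ _; rewrite lee_fin exprn_ge0.
  rewrite big_nat_recr //= leeDr //; apply: sume_ge0 => i _.
  by rewrite lee_fin exprn_ge0.
pose c l j := if l is 0%N then U j else if l is 1%N then cball (x j) (r j) else set0.
have [V [VU Vd Vs]] := double_sequence_sum c (hterm_ge0 s).
apply: (@le_trans _ _ (\sum_(k <oo) hterm s (V k))%E).
  apply: ereal_inf_lbound; exists V; split.
    move=> y [Ay|Zy].
      have [j _ Uj] := AU y Ay; have [k Vk] := VU 0%N j.
      by exists k => //; rewrite Vk.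
    have [j _ Uj] := cov y Zy; have [k Vk] := VU 1%N j.
    by exists k => //; rewrite Vk.
  split=> // k; have [l [j ->]] := Vd k; case: l => [|[|l]] //=.
    by apply: le_trans (cdiam_cball _ _) _; rewrite lee_fin (le_trans (rrho j)) // ge_min lexx.
  by rewrite cdiam0 leNye.
rewrite Vs [leLHS](@nneseries_eventually0 _ _ 2); last 2 first.
- by move=> l; apply: nneseries_ge0 => *; exact: hterm_ge0.
- by move=> [|[|l]] //= _; rewrite eseries0 // => j _ _; rewrite hterm0.
rewrite big_ord_recr big_ord1 /=; apply: leeD => //.
apply: (@le_trans _ _ (\sum_(j <oo) (2 ^+ p)%:E * (r j ^+ p)%:E)%E).
  apply: lee_nneseries => j _; first by move=> _; exact: hterm_ge0.
  rewrite -EFinM; apply: hterm_cball => //.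
  by rewrite (le_trans (rrho j)) // ge_min lexx orbT.
rewrite nneseriesZl; last by move=> j _; rewrite lee_fin exprn_ge0.
apply: (@le_trans _ _ ((2 ^+ p)%:E * e'%:E)%E).
  exact: lee_wpmul2l.
rewrite -EFinM lee_fin -ler_pdivlMl ?exprn_gt0 // mulrC.
by rewrite ge_min lexx orbT.
Qed.

Lemma hausdorff_subset (s : R) A B : A `<=` B -> (hausdorff s A <= hausdorff s B)%E.
Proof.
move=> AB; apply: ge_ereal_sup => _ [d [d0 ->]].
apply: le_trans (hausdorff_delta_le s B d0).
apply: le_ereal_inf_tmp => _ [U [BU [Ud ->]]]; apply: ereal_inf_lbound; exists U; split=> //.
exact: subset_trans BU.
Qed.

Lemma hausdorff_null (s : R) (p : nat) A : (0 < p)%N -> p%:R <= s ->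
  ball_null p A -> hausdorff s A = 0%E.
Proof.
move=> p0 ps nA; apply/eqP; rewrite eq_le hausdorff_ge0 andbT.
by have := hausdorff_setU_null set0 p0 ps nA; rewrite set0U hausdorff_set0.
Qed.

(** Removing [Z] from each piece of a simple function on [M] leaves Borel pieces inside [Y], of no
    smaller measure by [hausdorff_setU_null]. *)
Lemma lintegral_null_diff (s : R) (p : nat) (f : chpt R a n -> R) M Y Z :
  (0 < p)%N -> p%:R <= s -> ball_null p Z -> cborel Z ->
  Y `<=` M -> M `<=` Y `|` Z ->
  lintegral (hausdorff s) Y f = lintegral (hausdorff s) M f.
Proof.
move=> p0 ps nZ bZ YM MYZ; apply/eqP; rewrite eq_le; apply/andP; split.
  apply: ereal_sup_le => _ [k [c [E [EP [Ed ->]]]]]; exists k, c, E; split=> // i ik.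
  by have [b1 b2 b3 b4] := EP i ik; split=> //; apply: subset_trans YM.
apply: ge_ereal_sup => _ [k [c [E [EP [Ed ->]]]]].
apply: (@le_trans _ _ (\sum_(i < k) (c i)%:E * hausdorff s (E i `\` Z))%E).
  apply: lee_sum => i _; have [_ _ c0 _] := EP i (ltn_ord i).
  apply: lee_wpmul2l; first by rewrite lee_fin.
  apply: le_trans (hausdorff_setU_null (E i `\` Z) p0 ps nZ).
  by apply: hausdorff_subset => x Ex; have [Zx|nZx] := pselect (Z x); [right|left].
apply: ereal_sup_ubound; exists k, c, (fun i => E i `\` Z); split.
  move=> i ik; have [b1 b2 b3 b4] := EP i ik; split=> //.
  - exact: cborelD.
  - by move=> x [/b2 /MYZ[]].
  - by move=> x [/b4].
split=> // i j ik jk ij; apply/seteqP; split=> // x [[Ex _] [Ex' _]].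
by rewrite -(Ed i j ik jk ij).
Qed.

(** [phi] sends a set of diameter D into a box of side 2D. If s < K and D <= 1, then D^K <= D^s, so
    a cover with small s-sum would give boxes covering the unit cube with total volume below 1. *)
Lemma hausdorff_dim_lower (M : set (chpt R a n)) (K : nat) (phi : chpt R a n -> nat -> R) (s : R) :
  (forall x y i, (i < K)%N -> `|phi x i - phi y i| <= cdist x y) ->
  (forall u : nat -> R, (forall i, (i < K)%N -> 0 <= u i <= 1) ->
     exists2 x, M x & forall i, (i < K)%N -> phi x i = u i) ->
  0 <= s -> hausdorff s M = 0%E -> K%:R <= s.
Proof.
move=> lip surj s0 M0; rewrite leNgt; apply/negP => sK.
have K0 : (0 < K)%N by rewrite -(ltr0n R) (le_lt_trans s0).
(* Since (2D)^K = 2^K D^K, this bound makes the total volume less than 1/2. *)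
have : (hausdorff_delta s 1 M < ((2 ^+ K)^-1 / 2)%:E)%E.
  apply: le_lt_trans (hausdorff_delta_le s M ltr01) _; rewrite M0 lte_fin.
  by rewrite divr_gt0 // invr_gt0 exprn_gt0.
move=> /ereal_inf_lt[_ [U [MU [Ud ->]]] small].
pose J j := `[< U j !=set0 >].
have /choice[pt ptP] : forall j, exists x, J j -> U j x.
  move=> j; have [/asboolP[x Ux]|nJ] := boolP (J j); first by exists x.
  by exists (fun=> 0).
pose D j : R := if J j then fine (cdiam (U j)) else 0.
have DP j : J j -> [/\ cdiam (U j) = (D j)%:E, 0 <= D j & D j <= 1].
  by move=> Jj; rewrite /D Jj; apply: cdiam_fin => //; apply/asboolP.
have D0 j : 0 <= D j by rewrite /D; case: ifP => // Jj; have [] := DP j Jj; rewrite /D Jj.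
have := @box_cover_volume R K J (fun j i => phi (pt j) i - D j) (fun j => 2 * D j).
have l0 j : 0 <= 2 * D j by rewrite mulr_ge0.
move=> /(_ l0) big.
suff : (1 <= \sum_(j <oo) ((J j)%:R * (2 * D j) ^+ K)%:E)%E.
  apply/negP; rewrite -ltNge.
  apply: (@le_lt_trans _ _ (\sum_(j <oo) (2 ^+ K)%:E * hterm s (U j))%E).
    apply: lee_nneseries => j _.
      by move=> _; rewrite lee_fin mulr_ge0 // exprn_ge0.
    rewrite /hterm -/(J j); case: ifP => Jj; last by rewrite mul0r mule0.
    rewrite mul1r -EFinM lee_fin exprMn ler_pM2l ?exprn_gt0 //.
    have [_ _ D1] := DP j Jj; have -> : fine (cdiam (U j)) = D j by rewrite /D Jj.
    rewrite -powR_mulrn //; move: (D0 j); rewrite le_eqVlt => /predU1P[<-|Dp].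
      by rewrite powR0 ?powR_ge0 // pnatr_eq0 -lt0n.
    by apply: ger_powR; rewrite ?Dp // ltW.
  rewrite nneseriesZl; last by move=> j _; exact: hterm_ge0.
  apply: (@lt_le_trans _ _ ((2 ^+ K)%:E * ((2 ^+ K)^-1 / 2)%:E)%E).
    by rewrite lte_pmul2l // lte_fin exprn_gt0.
  rewrite -EFinM lee_fin mulrA mulfV ?gt_eqF ?exprn_gt0 //; lra.
apply: big => u u01; have [x Mx xu] := surj u u01.
have [j _ Ux] := MU x Mx; exists j.
have Jj : J j by apply/asboolP; exists x.
split=> // i iK; rewrite -xu //; have [cD _ _] := DP j Jj.
have : `|phi x i - phi (pt j) i| <= D j.
  apply: le_trans (lip x (pt j) i iK) _; rewrite -lee_fin -cD.
  by apply: ereal_sup_ubound; exists x, (pt j); split=> //; split=> //; apply: ptP.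
by rewrite ler_norml => /andP[]; lra.
Qed.

(** Cut [-L, L]^p into N^p cells. The part of [S] over a cell lies in one ball of radius 4CL/N, and
    N^p (4CL/N)^q <= (4CL)^q / N < e. *)
Lemma ball_null_grid (S : set (chpt R a n)) (p q : nat) (phi : chpt R a n -> 'I_p -> R) (L C : R) :
  (p < q)%N -> 0 < L -> 0 < C ->
  (forall x t, S x -> `|phi x t| < L) ->
  (forall x y e, S x -> S y -> 0 <= e -> (forall t, `|phi x t - phi y t| <= e) ->
     cdist x y <= C * e) ->
  ball_null q S.
Proof.
move=> pq L0 C0 phiL lip e e0.
pose B := (4 * C * L) ^+ q.
have B0 : 0 < B by rewrite exprn_gt0 // !mulr_gt0.
pose N := (Num.truncn (B / e)).+1.
have NB : B / e < N%:R by exact: truncnS_gt.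
have N0 : 0 < N%:R :> R by [].
pose scaled x t := (phi x t + L) * N%:R / (2 * L).
pose code x : {ffun 'I_p -> 'I_N} := [ffun t => inord (Num.truncn (scaled x t))].
have scaled_bnd x t : S x -> 0 <= scaled x t < N%:R.
  move=> Sx; have := phiL x t Sx; rewrite ltr_norml => /andP[l1 l2].
  rewrite /scaled divr_ge0 ?mulr_ge0 //=; [|lra..].
  by rewrite ltr_pdivrMr ?mulr_gt0 // mulrC ltr_pM2l //; lra.
pose F := {: {ffun 'I_p -> 'I_N}}.
pose cell j := nth [ffun=> ord0] (enum F) j.
have /choice[pt ptP] : forall j, exists x, forall y, S y -> code y = cell j ->
    S x /\ code x = cell j.
  move=> j; have [[x [Sx cx]]|ne] := pselect (exists x, S x /\ code x = cell j).
    by exists x.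
  by exists (fun=> 0) => y Sy cy; case: ne; exists y.
(* Points over one cell are within 2CL/N; doubling makes the inequality strict, as open balls
   require. *)
pose rad := 4 * C * L / N%:R.
have rad0 : 0 < rad by rewrite divr_gt0 // !mulr_gt0.
pose r j := if (j < #|F|)%N then rad else 0.
exists pt, r; split.
- by move=> j; rewrite /r; case: ifP => // _; exact: ltW.
- move=> x Sx; exists (index (code x) (enum F)) => //.
  have lti : (index (code x) (enum F) < #|F|)%N by rewrite cardE index_mem mem_enum.
  rewrite /r lti; set j := index _ _.
  have cj : code x = cell j by rewrite /cell nth_index ?mem_enum.
  have [Spt cpt] := ptP j x Sx cj.
  rewrite /cball /=; apply: (@le_lt_trans _ _ (C * (2 * L / N%:R))).
    apply: lip => //; first by rewrite divr_ge0 // mulr_ge0 // ltW.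
    move=> t; have /andP[u0 uN] := scaled_bnd _ t Spt; have /andP[v0 vN] := scaled_bnd _ t Sx.
    have tr : Num.truncn (scaled (pt j) t) = Num.truncn (scaled x t).
      have /ffunP/(_ t) := etrans cpt (esym cj); rewrite !ffunE => /(congr1 val) /=.
      by rewrite !inordK // truncn_lt_nat.
    have /andP[u1 u2] := truncn_itv u0; have /andP[v1 v2] := truncn_itv v0.
    rewrite tr in u1 u2.
    have -> : phi (pt j) t - phi x t = (scaled (pt j) t - scaled x t) * (2 * L / N%:R).
      by rewrite /scaled; field; rewrite !gt_eqF.
    have c0 : 0 <= 2 * L / N%:R by rewrite divr_ge0 // mulr_ge0 // ltW.
    rewrite normrM (ger0_norm c0) ler_piMl // ler_norml.
    by move: u2 v2; rewrite -natr1; lra.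
  rewrite /rad mulrA ltr_pM2r ?invr_gt0 //.
  have := mulr_gt0 C0 L0; lra.
rewrite (@nneseries_eventually0 _ _ #|F|); last 2 first.
- by move=> j; rewrite lee_fin exprn_ge0 // /r; case: ifP => // _; exact: ltW.
- by move=> j; rewrite leqNgt /r => /negbTE ->; rewrite expr0n gtn_eqF // (leq_ltn_trans _ pq).
under eq_bigr => j _ do rewrite /r ltn_ord.
rewrite sumEFin lee_fin sumr_const card_ord card_ffun !card_ord -mulr_natl natrX.
rewrite /rad expr_div_n -/B mulrA ler_pdivrMr ?exprn_gt0 //.
rewrite -(subnKC (ltnW pq)) exprD mulrCA ler_pM2l ?exprn_gt0 //.
apply: (@le_trans _ _ (e * N%:R)); first by rewrite mulrC -ler_pdivrMr // ltW.
by rewrite ler_pM2l // -[leLHS]expr1 ler_weXn2l ?subn_gt0 // ler1n.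
Qed.

End Hausdorff.

(** * The variety of complexes *)

Section ChainVariety.
Variables (R : realType) (n m : nat).
Local Notation space := (chpt R (fun=> m) n).
Implicit Types d : space.

Lemma ball_null_countable (p : nat) (T : countType) (A : T -> set space) :
  (0 < p)%N -> (forall t, ball_null p (A t)) -> ball_null p (\bigcup_t A t).
Proof.
move=> p0 nA.
pose B l := if unpickle l is Some t then A t else set0.
apply: (@ball_null_subset _ _ _ _ _ (\bigcup_l B l)).
  by move=> x [t _ At]; exists (pickle t) => //; rewrite /B pickleK.
apply: ball_null_bigcup => l; rewrite /B; case: unpickle => // e e0.
exists (fun _ _ => 0), (fun=> 0); split=> //.
by rewrite eseries0 ?lee_fin ?ltW // => j _ _; rewrite expr0n gtn_eqF.
Qed.

(** Extension by zero keeps the chain condition at every index, as the chart lemmas for infinite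
    sequences require. *)
Definition differentials d (i : nat) : 'M[R]_m :=
  if (insub i : option 'I_n) is Some o then d o else 0.

Lemma differentials_lt d i (lti : (i < n)%N) : differentials d i = d (Ordinal lti).
Proof. by rewrite /differentials insubT. Qed.

Lemma differentials_ord d (i : 'I_n) : differentials d i = d i.
Proof. by rewrite /differentials valK. Qed.

Lemma differentials_ge d i : (n <= i)%N -> differentials d i = 0.
Proof. by move=> lei; rewrite /differentials insubF // ltnNge lei. Qed.

Lemma differentials_chain d : is_chain d ->
  forall i, differentials d i *m differentials d i.+1 = 0.
Proof.
move=> ch i; case: (ltnP i.+1 n) => [lti|lei]; last by rewrite (differentials_ge d lei) mulmx0.
by rewrite (differentials_lt d lti) (differentials_lt d (ltnW lti)); exact: ch.
Qed.

Lemma crank_rank_seq d i : crank d i = rank_seq (differentials d) i.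
Proof.
case: i => //= i; rewrite /differentials.
by case: insub => //; rewrite mxrank0.
Qed.

Lemma betti_rank_betti d i : betti d i = rank_betti m (rank_seq (differentials d)) i.
Proof. by rewrite /betti !crank_rank_seq. Qed.

Lemma chain_rank_vector d : is_chain d -> rank_vector m n (rank_seq (differentials d)).
Proof.
move=> ch; split=> //; first by rewrite /= differentials_ge // mxrank0.
move=> [|i] _; first exact: rank_leq_row.
by apply: mulmx0_rank_max; exact: differentials_chain.
Qed.

Lemma chart_ball_null (I J : nat -> {set 'I_m}) (L q : nat) :
  (#|chart_coords n I J| < q)%N ->
  ball_null q [set d | exists G, in_chart n I J L%:R (differentials d, G)].
Proof.
move=> Tq; have [C C0 lip] := chart_projection_inverse_lip n I J (L%:R : R).
pose S : R := \sum_(i < n) \sum_(r < m) \sum_(c < m) 1 + 1.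
have S0 : 0 < S by rewrite ltr_wpDl // sumr_ge0 // => *; rewrite sumr_ge0 // => *; rewrite sumr_ge0.
pose phi d (t : 'I_#|chart_coords n I J|) :=
  let c := enum_val t in differentials d c.1 c.2.1 c.2.2.
(* [L] may be 0, while the grid takes a positive bound. *)
apply: (@ball_null_grid _ _ _ _ _ _ phi L.+1%:R (S * C)) => //.
- exact: mulr_gt0.
- move=> d t [G [_ _ _ bnd _]].
  have [/lt_le_trans -> //] := bnd _ (enum_val t).2.1 (enum_val t).2.2 (ltn_ord (enum_val t).1).
  by rewrite ler_nat.
move=> d d' e [G DG] [G' DG'] e0 close; rewrite -mulrA.
apply: cdist_le_entries; first by rewrite mulr_ge0 // ltW.
move=> i r c; rewrite -!differentials_ord.
apply: lip DG DG' e0 _ i r c => t tT.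
by have := close (enum_rank_in tT t); rewrite /phi enum_rankK_in.
Qed.

Lemma strata_ball_null (q : nat) : (0 < q)%N ->
  ball_null q [set d | is_chain d /\ (stratum_dim m n (rank_seq (differentials d)) < q)%N].
Proof.
move=> q0.
pose A (t : seq {set 'I_m} * seq {set 'I_m} * nat) : set space :=
  let I := nth finset.set0 t.1.1 in let J := nth finset.set0 t.1.2 in
  [set d | (#|chart_coords n I J| < q)%N /\
           exists G, in_chart n I J t.2%:R (differentials d, G)].
apply: (@ball_null_subset _ _ _ _ _ (\bigcup_t A t)).
  move=> d [/differentials_chain ch dq].
  have [sI [sJ [L [G [inG cT]]]]] := chart_cover n ch.
  by exists (sI, sJ, L) => //; split; [rewrite cT|exists G].
apply: ball_null_countable => // t.
have [lt|ge] := boolP (#|chart_coords n (nth finset.set0 t.1.1) (nth finset.set0 t.1.2)| < q)%N.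
  by apply: ball_null_subset (chart_ball_null t.2 lt) => d [].
apply: (@ball_null_subset _ _ _ _ _ (\bigcup_(u : void) set0)).
  by move=> d []; rewrite (negbTE ge).
by apply: ball_null_countable => // -[].
Qed.

(** A crude bound, giving an exponent in the set whose infimum is [kdim]. *)
Lemma chain_variety_null (q : nat) : (n * (m * (m + m)) < q)%N ->
  ball_null q (chain_variety R (fun=> m) n).
Proof.
move=> nq; apply: ball_null_subset (strata_ball_null (leq_ltn_trans (leq0n _) nq)) => d ch.
split=> //; apply: leq_ltn_trans nq.
rewrite -[X in (_ <= X * _)%N]card_ord -sum_nat_const; apply: leq_sum => i _.
apply: leq_mul; first exact: rank_leq_row.
by rewrite leq_add2l -subnDA leq_subr.
Qed.

(** By [chart_realize], the chart coordinates shifted by m + 1 on the diagonal take every value in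
    the unit cube, so [hausdorff_dim_lower] bounds each exponent of measure zero. *)
Lemma kdim_ge (r : nat -> nat) : rank_vector m n r ->
  (0 < stratum_dim m n r)%N -> (stratum_dim m n r)%:R <= kdim R (fun=> m) n.
Proof.
move=> rv; have [J [J0 JJ cT]] := block_sets rv; rewrite -cT.
set T := chart_coords n _ J => /card_gt0P[t0 t0T].
apply: lb_le_inf.
  exists (n * (m * (m + m))).+1%:R; split=> //.
  exact: (hausdorff_null _ _ (chain_variety_null (leqnn _))).
move=> s [s0 Ms0].
pose base (a b : 'I_m) : R := (m.+1 * (a == b))%:R.
pose phi d k := let t := nth t0 (enum T) k in
  differentials d t.1 t.2.1 t.2.2 - base t.2.1 t.2.2.
apply: (hausdorff_dim_lower (phi := phi)) s0 Ms0.
  move=> d d' k _; rewrite /phi /=; set t := nth _ _ _.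
  rewrite opprB addrA subrK.
  by rewrite !differentials_ord; exact: cdist_entry.
move=> u u01.
(* The point [u] is spread over the coordinates in [T]; all other entries stay at [base]. *)
pose X i : 'M[R]_m := \matrix_(a, b) (base a b +
  (if (insub i : option 'I_n) is Some o then
    (if (o, (a, b)) \in T then u (index (o, (a, b)) (enum T)) else 0) else 0)).
have Xb i a b : (m.+1 * (a == b))%:R <= X i a b <= (m.+1 * (a == b))%:R + 1.
  rewrite mxE -/(base a b); case: insub => [j|]; last by lra.
  case: ifP => jT; last by lra.
  have /u01 : (index (j, (a, b)) (enum T) < #|T|)%N.
    by rewrite cardE index_mem mem_enum.
  by move=> /andP[]; lra.
have [e [ch eX]] := chart_realize n J0 JJ Xb.
exists (fun i => e i); first by move=> i Hi; exact: ch.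
move=> k kT; rewrite /phi differentials_ord; set t := nth _ _ _.
have tT : t \in T by rewrite -mem_enum mem_nth // -cardE.
rewrite eX // mxE valK -!surjective_pairing tT index_uniq ?enum_uniq -?cardE //.
by rewrite addrC addKr.
Qed.

End ChainVariety.

Theorem theorem4p2 (R : realType) (n m : nat) :
  (0 < n)%N -> ~~ odd n -> (0 < m)%N ->
  forall f : chpt R (fun _ => m) n -> R,
    (forall x, 0 <= f x) ->
    (exists C : R, forall x, f x <= C) ->
    cborel_fun f ->
    (0 < lintegral (hausdorff (kdim R (fun _ => m) n))
                   (chain_variety R (fun _ => m) n) f)%E ->
    (lintegral (hausdorff (kdim R (fun _ => m) n))
               (chain_variety R (fun _ => m) n) f < +oo)%E ->
    Pr f [set d | is_chain d /\
            \sum_(i < n.+1) betti d i = `|euler_char (fun _ => m) n| /\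
            (forall i : nat, odd i -> (i < n)%N -> betti d i = 0)] = 1.
Proof.
move=> n0 evn m0 f _ _ _ pos fin.
have bv := best_rank_vector m evn; have K0 := best_rank_dim_gt0 n0 evn m0.
set K := stratum_dim m n (best_rank m n) in K0.
have [Z [bZ badZ nZ]] := ball_null_borel (@strata_ball_null R n m _ K0).
(* The variety exceeds the event only inside [Z], so numerator and denominator of [Pr] coincide. *)
rewrite /Pr (lintegral_null_diff f K0 (@kdim_ge R _ _ _ bv K0) nZ bZ
  (M := chain_variety R (fun=> m) n)).
- by rewrite divff // gt_eqF // fine_gt0 // pos fin.
- by move=> d [].
move=> d ch; have [bad|good] := boolP (stratum_dim m n (rank_seq (differentials d)) < K)%N.
  by right; apply: badZ.
have rv := chain_rank_vector ch.
have od i : odd i -> (i < n)%N -> rank_betti m (rank_seq (differentials d)) i = 0.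
  move=> oi lti; apply/eqP; apply: contraNT good; exact: best_rank_optimal.
left; split=> //; split=> [|i oi lti]; last by rewrite betti_rank_betti od.
under eq_bigr do rewrite betti_rank_betti.
rewrite (betti_sum rv evn od) /euler_char.
(* As [n.+1] is odd, the Euler characteristic is [m]. *)
suff H k : \sum_(i < k) (-1) ^+ i * m%:Z = (odd k)%:R * m%:Z by rewrite H /= evn mul1r.
elim: k => [|k IH]; first by rewrite big_ord0 mul0r.
by rewrite big_ord_recr /= IH -signr_odd; case: (odd k) => /=; lia.
Qed.
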